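(* Let $\ell,\ell'$ be geodesic lines of $\mathbb{H}^2$ and $g,g'\in G_0$. The following are equivalent: (1) the left $\mathrm{AdS}$ crooked planes $g\mathsf{C}(\ell)$ and $g'\mathsf{C}(\ell')$ are disjoint; (2) there exists $K>0$ such that $d(g\cdot x,g'\cdot x')-d(x,x')\geq K$ for all $x\in\ell$, $x'\in\ell'$; (3) for any endpoint $\xi$ of $\ell$ and any endpoint $\xi'$ of $\ell'$, we have $g\cdot\xi\neq g'\cdot\xi'$ and $F_{g,g'}(\xi,\xi')>0$. If these conditions hold, then $g\cdot\ell$ and $g'\cdot\ell'$ have disjoint closures in $\overline{\mathbb{H}^2}$. Moreover, given transverse orientations of $g\cdot\ell$ and $g'\cdot\ell'$ (and the transverse orientations of $\ell,\ell'$ induced via $g^{-1},g'^{-1}$), the closed left crooked half-spaces $g\,\overline{\mathsf{H}_+(\ell)}$ and $g'\,\overline{\mathsf{H}_+(\ell')}$ are disjoint if and only if (1), (2), (3) hold and $g\cdot\ell$ and $g'\cdot\ell'$ are transversely oriented away from each other.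
   Context: $\mathbb{H}^2$ is the hyperbolic plane with metric $d$, $\overline{\mathbb{H}^2}=\mathbb{H}^2\cup\partial_\infty\mathbb{H}^2$, $G_0=\mathrm{PSL}_2(\mathbb{R})$, and $\mathrm{AdS}^3$ is identified with $G_0$ (with bi-invariant Lorentzian metric from half the Killing form). For a geodesic line $\ell$ with closure $\overline\ell$, $\mathsf{C}(\ell)$ is the set of $h\in G_0$ having a nonrepelling fixed point in $\overline\ell$ (identity: every point; elliptic: its fixed point in $\mathbb{H}^2$; parabolic: its fixed point at infinity; hyperbolic: its attracting fixed point). If $\ell$ is transversely oriented, $\mathsf{H}_+(\ell)$ is the set of nontrivial $h\in G_0$ having a nonrepelling fixed point in $\overline{\mathbb{H}^2}\smallsetminus\overline\ell$ on the positive side of $\overline\ell$, and $\overline{\mathsf{H}_+(\ell)}=\mathsf{H}_+(\ell)\cup\mathsf{C}(\ell)$. For $g,g'\in G_0$, $F_{g,g'}(x,x')=d(g\cdot x,g'\cdot x')-d(x,x')$ for $x,x'\in\mathbb{H}^2$, and for ideal points $\xi,\xi'$ (not with both $\xi=\xi'$ and $g\cdot\xi=g'\cdot\xi'$) it is the continuous extension, given by $F_{g,g'}(\xi,\xi')=d(g\cdot B,g'\cdot B')-d(B,B')$ for any sufficiently small horoballs $B,B'$ centered at $\xi,\xi'$; here the distance between disjoint sets is the infimum of pointwise distances, and the distance between concentric horoballs is declared to be $-\infty$. *)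

(* Defs.v *)
From Stdlib Require Import Reals.
Open Scope R_scope.

(* ---------- The group G0 = PSL_2(R), represented by SL_2(R) matrices ---------- *)
Record Mat := mkMat { ma : R; mb : R; mc : R; md : R }.

Definition inSL (m : Mat) : Prop := ma m * md m - mb m * mc m = 1.

Definition mmul (m n : Mat) : Mat :=
  mkMat (ma m * ma n + mb m * mc n) (ma m * mb n + mb m * md n)
        (mc m * ma n + md m * mc n) (mc m * mb n + md m * md n).

Definition mopp (m : Mat) : Mat := mkMat (- ma m) (- mb m) (- mc m) (- md m).

(* equality in PSL_2(R) = SL_2(R)/{+-1} *)
Definition peq (m n : Mat) : Prop := m = n \/ m = mopp n.

Definition isId (m : Mat) : Prop := peq m (mkMat 1 0 0 1).

Definition trace (m : Mat) : R := ma m + md m.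
Definition elliptic (m : Mat) : Prop := Rabs (trace m) < 2.
Definition parabolic (m : Mat) : Prop := Rabs (trace m) = 2 /\ ~ isId m.
Definition hyperbolic (m : Mat) : Prop := Rabs (trace m) > 2.

(* ideal boundary = R u {oo}, encoded as option R (None = oo) *)
Inductive pt := Int (z : R * R) | Ide (xi : option R).

Definition valid (p : pt) : Prop :=
  match p with Int z => snd z > 0 | Ide _ => True end.

(* Moebius action z |-> (az+b)/(cz+d) on the upper half-plane *)
Definition actH (m : Mat) (z : R * R) : R * R :=
  let x := fst z in let y := snd z in
  let D := (mc m * x + md m) ^ 2 + (mc m * y) ^ 2 in
  (((ma m * x + mb m) * (mc m * x + md m) + ma m * mc m * y ^ 2) / D, y / D).

Definition actB (m : Mat) (xi : option R) : option R :=
  match xi with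
  | Some x => if Req_dec_T (mc m * x + md m) 0 then None
              else Some ((ma m * x + mb m) / (mc m * x + md m))
  | None => if Req_dec_T (mc m) 0 then None else Some (ma m / mc m)
  end.

Definition act (m : Mat) (p : pt) : pt :=
  match p with Int z => Int (actH m z) | Ide xi => Ide (actB m xi) end.

Definition arcosh (t : R) : R := ln (t + sqrt (t ^ 2 - 1)).
Definition dH (z w : R * R) : R :=
  arcosh (1 + ((fst z - fst w) ^ 2 + (snd z - snd w) ^ 2) / (2 * snd z * snd w)).

(* ---------- Geodesic lines, given by their two (distinct) endpoints ---------- *)
Definition onGeod (p q : option R) (z : R * R) : Prop :=
  snd z > 0 /\
  match p, q with
  | Some a, Some b => (fst z - (a + b) / 2) ^ 2 + snd z ^ 2 = ((a - b) / 2) ^ 2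
  | Some a, None | None, Some a => fst z = a
  | None, None => False
  end.

Definition inClosure (p q : option R) (P : pt) : Prop :=
  match P with Int z => onGeod p q z | Ide xi => xi = p \/ xi = q end.

Definition imgClos (g : Mat) (p q : option R) (P : pt) : Prop :=
  exists P0, inClosure p q P0 /\ act g P0 = P.

(* homogeneous coordinates of an ideal point *)
Definition vec (xi : option R) : R * R :=
  match xi with Some x => (x, 1) | None => (1, 0) end.
Definition det2 (u v : R * R) : R := fst u * snd v - snd u * fst v.

(* S vanishes exactly on the closure of the geodesic with endpoints p, q; its sign
   (normalised by det2 (vec p) (vec q)) distinguishes the two sides. *)
Definition Sfun (p q : option R) (P : pt) : R :=
  let (p1, p2) := vec p in let (q1, q2) := vec q in
  match P with
  | Int z => (fst z * p2 - p1) * (fst z * q2 - q1) + snd z ^ 2 * p2 * q2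
  | Ide xi => let (x1, x2) := vec xi in (x1 * p2 - x2 * p1) * (x1 * q2 - x2 * q1)
  end.

(* the positive / negative side of the geodesic with endpoints p,q, transversely
   oriented according to the order of (p,q) *)
Definition posSide (p q : option R) (P : pt) : Prop :=
  valid P /\ det2 (vec p) (vec q) * Sfun p q P > 0.
Definition negSide (p q : option R) (P : pt) : Prop :=
  valid P /\ det2 (vec p) (vec q) * Sfun p q P < 0.

(* attracting fixed point on the boundary: multiplier of the Moebius map < 1 *)
Definition attracting (h : Mat) (xi : option R) : Prop :=
  match xi with
  | Some x => Rabs (mc h * x + md h) > 1
  | None => Rabs (ma h) > 1
  end.

Definition nonrep (h : Mat) (P : pt) : Prop :=
  valid P /\
  (isId h
   \/ (elliptic h /\ (exists z, P = Int z) /\ act h P = P)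
   \/ (parabolic h /\ (exists xi, P = Ide xi) /\ act h P = P)
   \/ (hyperbolic h /\ exists xi, P = Ide xi /\ actB h xi = xi /\ attracting h xi)).

Definition Cset (p q : option R) (h : Mat) : Prop :=
  exists P, inClosure p q P /\ nonrep h P.

Definition Hplus (Pos : pt -> Prop) (p q : option R) (h : Mat) : Prop :=
  ~ isId h /\ exists P, valid P /\ ~ inClosure p q P /\ Pos P /\ nonrep h P.

Definition Hbar (Pos : pt -> Prop) (p q : option R) (h : Mat) : Prop :=
  Hplus Pos p q h \/ Cset p q h.

Definition leftTr (g : Mat) (S : Mat -> Prop) (k : Mat) : Prop :=
  exists h, inSL h /\ S h /\ peq k (mmul g h).

Definition disjointG (S T : Mat -> Prop) : Prop :=
  ~ exists k, inSL k /\ S k /\ T k.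

Inductive ER := Fin (r : R) | PInf | MInf.

Definition ersub (u v : ER) : ER :=
  match u, v with
  | Fin a, Fin b => Fin (a - b)
  | Fin _, MInf => PInf
  | MInf, Fin _ => MInf
  | _, _ => Fin 0 (* never used: concentric on both sides is excluded *)
  end.

Definition erpos (u : ER) : Prop :=
  match u with Fin a => a > 0 | PInf => True | MInf => False end.

(* open horoball centred at xi with size parameter s > 0 (smaller s = smaller) *)
Definition horo (xi : option R) (s : R) (z : R * R) : Prop :=
  snd z > 0 /\
  match xi with
  | Some a => (fst z - a) ^ 2 + snd z ^ 2 < s * snd z
  | None => s * snd z > 1
  end.

Definition imgSet (g : Mat) (B : R * R -> Prop) (z : R * R) : Prop :=
  exists z0, B z0 /\ actH g z0 = z.

Definition setdist (A B : R * R -> Prop) (r : R) : Prop :=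
  (forall u v, A u -> B v -> r <= dH u v) /\
  (forall r', (forall u v, A u -> B v -> r' <= dH u v) -> r' <= r).

Definition hdist (xi eta : option R) (A B : R * R -> Prop) (v : ER) : Prop :=
  (xi = eta /\ v = MInf) \/ (xi <> eta /\ exists r, v = Fin r /\ setdist A B r).

Definition Fval (g g' : Mat) (xi xi' : option R) (v : ER) : Prop :=
  exists s0, s0 > 0 /\
    forall s s', 0 < s <= s0 -> 0 < s' <= s0 ->
      exists v1 v2,
        hdist (actB g xi) (actB g' xi') (imgSet g (horo xi s)) (imgSet g' (horo xi' s')) v1 /\
        hdist xi xi' (horo xi s) (horo xi' s') v2 /\
        ersub v1 v2 = v.

Definition Fpos (g g' : Mat) (xi xi' : option R) : Prop :=
  exists v, Fval g g' xi xi' v /\ erpos v.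

(* Main.v *)
Require Import Defs.
From Stdlib Require Import Reals Lra Psatz Classical.
Open Scope R_scope.

(* Points of the hyperbolic plane and its boundary are rays in the cone of nonzero
   positive semidefinite symmetric 2x2 matrices, an ideal point being the rank-one matrix
   of its homogeneous coordinates.  The polarised determinant [pairing] is 2 cosh d on
   matrices of determinant 1, and an isometry [h] has the nonrepelling fixed point [P] iff
   it multiplies the matrix of [P] by some [l >= 1].

   Let u, v and u', v' be the coordinates of the endpoints of l and l', and put
   M_ij = det (u_i, u'_j), N_ij = det (g u_i, g' u'_j).  Both matrices have determinant
   det (u, v) det (u', v').  In terms of them, (3) says M_ij^2 < N_ij^2 for all i, j.  The
   points of l are the nonnegative combinations of u u^T and v v^T, so these inequalities
   multiply the pairing on l x l' by a factor bounded below by some lam > 1, which is (2)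
   with K = ln lam; conversely (3) is the limit of (2) at the ends.  An element common to
   both crooked planes cannot increase the pairing of its fixed points, against (3).  If
   instead (3) fails for one pair of endpoints, such an element is built by prescribing its
   values on a basis.

   The closed positive side of l consists of the combinations of u u^T, u v^T + v u^T and
   v v^T with a middle coefficient of fixed sign.  The lines being oriented away from each
   other means that the N_ij have signs making all mixed terms of the pairing favourable,
   so domination of the endpoints extends to the closed half-planes.  If the lines are not
   so oriented, some endpoint g' p' lies on the closed positive side of g l, and the
   construction applied to g^-1 g' p' and p' gives a common element. *)

(** * Symmetric matrices and fixed points *)

Record Sym := mkSym { sA : R; sB : R; sC : R }.

Definition sscale (r : R) (X : Sym) : Sym := mkSym (r * sA X) (r * sB X) (r * sC X).

(** Congruence [X -> m X m^T], under which the rank-one matrix of [u] goes to that of [mv m u]. *)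
Definition sact (m : Mat) (X : Sym) : Sym :=
  mkSym (ma m ^ 2 * sA X + 2 * ma m * mb m * sB X + mb m ^ 2 * sC X)
        (ma m * mc m * sA X + (ma m * md m + mb m * mc m) * sB X + mb m * md m * sC X)
        (mc m ^ 2 * sA X + 2 * mc m * md m * sB X + md m ^ 2 * sC X).

Definition pairing (X Y : Sym) : R := sA X * sC Y - 2 * sB X * sB Y + sC X * sA Y.

Definition sdet (X : Sym) : R := sA X * sC X - sB X ^ 2.

(** An interior point is normalised by lower right entry 1, so that its determinant is its squared
    height; distances appear after division by the heights. *)
Definition toSym (P : pt) : Sym :=
  match P with
  | Int z => mkSym (fst z ^ 2 + snd z ^ 2) (fst z) 1
  | Ide xi => mkSym (fst (vec xi) ^ 2) (fst (vec xi) * snd (vec xi)) (snd (vec xi) ^ 2)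
  end.

Definition mv (m : Mat) (u : R * R) : R * R :=
  (ma m * fst u + mb m * snd u, mc m * fst u + md m * snd u).

Definition vscale (r : R) (u : R * R) : R * R := (r * fst u, r * snd u).

Definition minv (m : Mat) : Mat := mkMat (md m) (- mb m) (- mc m) (ma m).

(** This is [a u u^T + b (u v^T + v u^T) + c v v^T]. *)
Definition comb (u v : R * R) (a b c : R) : Sym :=
  mkSym (a * fst u ^ 2 + 2 * b * fst u * fst v + c * fst v ^ 2)
        (a * fst u * snd u + b * (fst u * snd v + snd u * fst v) + c * fst v * snd v)
        (a * snd u ^ 2 + 2 * b * snd u * snd v + c * snd v ^ 2).

Lemma sq_pos (x : R) : x <> 0 -> 0 < x ^ 2.
Proof. intros Hx; generalize (Rsqr_pos_lt x Hx); unfold Rsqr; simpl; lra. Qed.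

Lemma Sym_eq (X Y : Sym) : sA X = sA Y -> sB X = sB Y -> sC X = sC Y -> X = Y.
Proof. destruct X, Y; simpl; intros; subst; reflexivity. Qed.

Lemma Mat_eq (m n : Mat) :
  ma m = ma n -> mb m = mb n -> mc m = mc n -> md m = md n -> m = n.
Proof. destruct m, n; simpl; intros; subst; reflexivity. Qed.

Lemma pair_eq (u v : R * R) : fst u = fst v -> snd u = snd v -> u = v.
Proof. destruct u, v; simpl; intros; subst; reflexivity. Qed.

Lemma inSL_minv (m : Mat) : inSL m -> inSL (minv m).
Proof. unfold inSL, minv; simpl; lra. Qed.

Lemma inSL_mmul (m n : Mat) : inSL m -> inSL n -> inSL (mmul m n).
Proof.
  unfold inSL, mmul; simpl; intros Hm Hn.
  transitivity ((ma m * md m - mb m * mc m) * (ma n * md n - mb n * mc n)); [ring|].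
  rewrite Hm, Hn; ring.
Qed.

Lemma mmul_minv_r (g k : Mat) : inSL g -> mmul g (mmul (minv g) k) = k.
Proof.
  unfold inSL; intros Hg; apply Mat_eq; unfold mmul, minv; simpl.
  - transitivity ((ma g * md g - mb g * mc g) * ma k); [ring | rewrite Hg; ring].
  - transitivity ((ma g * md g - mb g * mc g) * mb k); [ring | rewrite Hg; ring].
  - transitivity ((ma g * md g - mb g * mc g) * mc k); [ring | rewrite Hg; ring].
  - transitivity ((ma g * md g - mb g * mc g) * md k); [ring | rewrite Hg; ring].
Qed.

Lemma sact_mmul (m n : Mat) (X : Sym) : sact (mmul m n) X = sact m (sact n X).
Proof. apply Sym_eq; unfold sact, mmul; simpl; ring. Qed.

Lemma sact_mopp (m : Mat) (X : Sym) : sact (mopp m) X = sact m X.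
Proof. apply Sym_eq; unfold sact, mopp; simpl; ring. Qed.

Lemma sact_peq (m n : Mat) (X : Sym) : peq m n -> sact m X = sact n X.
Proof. intros [-> | ->]; [reflexivity | apply sact_mopp]. Qed.

Lemma sact_sscale (m : Mat) (r : R) (X : Sym) : sact m (sscale r X) = sscale r (sact m X).
Proof. apply Sym_eq; unfold sact, sscale; simpl; ring. Qed.

Lemma sscale_sscale (r s : R) (X : Sym) : sscale r (sscale s X) = sscale (r * s) X.
Proof. apply Sym_eq; unfold sscale; simpl; ring. Qed.

Lemma sscale_1 (X : Sym) : sscale 1 X = X.
Proof. apply Sym_eq; unfold sscale; simpl; ring. Qed.

Lemma sact_minv (m : Mat) (X : Sym) : inSL m -> sact (minv m) (sact m X) = X.
Proof.
  unfold inSL; intros Hm; apply Sym_eq; unfold sact, minv; simpl.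
  - transitivity ((ma m * md m - mb m * mc m) ^ 2 * sA X); [ring | rewrite Hm; ring].
  - transitivity ((ma m * md m - mb m * mc m) ^ 2 * sB X); [ring | rewrite Hm; ring].
  - transitivity ((ma m * md m - mb m * mc m) ^ 2 * sC X); [ring | rewrite Hm; ring].
Qed.

Lemma pairing_sact (m : Mat) (X Y : Sym) : inSL m -> pairing (sact m X) (sact m Y) = pairing X Y.
Proof.
  unfold inSL; intros Hm.
  transitivity ((ma m * md m - mb m * mc m) ^ 2 * pairing X Y);
    [unfold pairing, sact; simpl; ring | rewrite Hm; ring].
Qed.

Lemma sdet_sact (m : Mat) (X : Sym) : inSL m -> sdet (sact m X) = sdet X.
Proof.
  unfold inSL; intros Hm.
  transitivity ((ma m * md m - mb m * mc m) ^ 2 * sdet X);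
    [unfold sdet, sact; simpl; ring | rewrite Hm; ring].
Qed.

Lemma pairing_sscale (r s : R) (X Y : Sym) :
  pairing (sscale r X) (sscale s Y) = r * s * pairing X Y.
Proof. unfold pairing, sscale; simpl; ring. Qed.

Lemma det2_mv (m : Mat) (u v : R * R) : inSL m -> det2 (mv m u) (mv m v) = det2 u v.
Proof.
  unfold inSL; intros Hm.
  transitivity ((ma m * md m - mb m * mc m) * det2 u v);
    [unfold det2, mv; simpl; ring | rewrite Hm; ring].
Qed.

Lemma sact_comb (m : Mat) (u v : R * R) (a b c : R) :
  sact m (comb u v a b c) = comb (mv m u) (mv m v) a b c.
Proof. apply Sym_eq; unfold sact, comb, mv; simpl; ring. Qed.

(** Bilinear expansion, starting from the pairing of [u u^T] with [u' u'^T], which is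
    [det2 u u' ^ 2]. *)
Lemma pairing_comb (u v u' v' : R * R) (a b c a' b' c' : R) :
  pairing (comb u v a b c) (comb u' v' a' b' c') =
    a * a' * det2 u u' ^ 2 + a * c' * det2 u v' ^ 2
    + c * a' * det2 v u' ^ 2 + c * c' * det2 v v' ^ 2
    + 2 * a * b' * (det2 u u' * det2 u v') + 2 * c * b' * (det2 v u' * det2 v v')
    + 2 * b * a' * (det2 u u' * det2 v u') + 2 * b * c' * (det2 u v' * det2 v v')
    + 2 * b * b' * (det2 u u' * det2 v v' + det2 u v' * det2 v u').
Proof. unfold pairing, comb, det2; simpl; ring. Qed.

Lemma pluecker (u v u' v' : R * R) :
  det2 u u' * det2 v v' - det2 u v' * det2 v u' = det2 u v * det2 u' v'.
Proof. unfold det2; ring. Qed.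

Lemma det2_vec_neq0 (xi eta : option R) : xi <> eta <-> det2 (vec xi) (vec eta) <> 0.
Proof.
  destruct xi as [x|], eta as [y|]; unfold det2; simpl; split; intros H.
  - intros E; apply H; f_equal; lra.
  - intros E; apply H; injection E; intros ->; ring.
  - intros E; lra.
  - discriminate.
  - intros E; lra.
  - discriminate.
  - exfalso; apply H; reflexivity.
  - exfalso; apply H; ring.
Qed.

Lemma toSym_Ide (xi eta : option R) : toSym (Ide xi) = comb (vec xi) (vec eta) 1 0 0.
Proof. apply Sym_eq; unfold toSym, comb; simpl; ring. Qed.

(** The factor [j] undoes the affine normalisation built into [vec]; at a fixed point it is an
    eigenvalue of [m]. *)
Lemma mv_vec (m : Mat) (xi : option R) :
  inSL m -> exists j, j <> 0 /\ mv m (vec xi) = vscale j (vec (actB m xi)).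
Proof.
  unfold inSL; intros Hm; destruct xi as [x|]; simpl.
  - destruct (Req_dec_T (mc m * x + md m) 0) as [E|E].
    + exists (ma m * x + mb m); split.
      * intros E'.
        assert (ma m * (mc m * x + md m) - mc m * (ma m * x + mb m) = 1) by (rewrite <- Hm; ring).
        rewrite E, E' in H; lra.
      * apply pair_eq; unfold mv, vscale; simpl; lra.
    + exists (mc m * x + md m); split; [exact E|].
      apply pair_eq; unfold mv, vscale; simpl; field; exact E.
  - destruct (Req_dec_T (mc m) 0) as [E|E].
    + exists (ma m); split.
      * intros E'; rewrite E, E' in Hm; lra.
      * apply pair_eq; unfold mv, vscale; simpl; lra.
    + exists (mc m); split; [exact E|].
      apply pair_eq; unfold mv, vscale; simpl; field; exact E.
Qed.

Lemma actH_denom_pos (m : Mat) (z : R * R) :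
  inSL m -> snd z > 0 -> (mc m * fst z + md m) ^ 2 + (mc m * snd z) ^ 2 > 0.
Proof.
  unfold inSL; intros Hm Hz.
  destruct (Req_dec_T (mc m) 0) as [E|E].
  - assert (md m <> 0) by (intros E'; rewrite E, E' in Hm; lra).
    rewrite E; nra.
  - assert (mc m * snd z <> 0).
    { apply Rmult_integral_contrapositive; split; [exact E | apply Rgt_not_eq; exact Hz]. }
    generalize (pow2_ge_0 (mc m * fst z + md m)) (sq_pos _ H); lra.
Qed.

Lemma valid_actH (m : Mat) (z : R * R) : inSL m -> snd z > 0 -> snd (actH m z) > 0.
Proof.
  intros Hm Hz; unfold actH; simpl.
  apply Rdiv_lt_0_compat; [lra|].
  generalize (actH_denom_pos m z Hm Hz); simpl; lra.
Qed.

Lemma valid_act (m : Mat) (P : pt) : inSL m -> valid P -> valid (act m P).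
Proof. intros Hm; destruct P; [apply valid_actH; exact Hm | trivial]. Qed.

(** The action preserves determinants, which are squared heights; this forces the ratio of heights
    as the factor, equal to [|c z + d|^2]. *)
Lemma sact_Int (m : Mat) (z : R * R) :
  inSL m -> snd z > 0 ->
  sact m (toSym (Int z)) = sscale (snd z / snd (actH m z)) (toSym (Int (actH m z))).
Proof.
  intros Hm Hz; generalize (actH_denom_pos m z Hm Hz); intros HD.
  set (D := (mc m * fst z + md m) ^ 2 + (mc m * snd z) ^ 2) in *.
  assert (Ey : snd (actH m z) = snd z / D) by reflexivity.
  assert (Ex : fst (actH m z) = ((ma m * fst z + mb m) * (mc m * fst z + md m)
                                 + ma m * mc m * snd z ^ 2) / D) by reflexivity.
  assert (ED : snd z / snd (actH m z) = D) by (rewrite Ey; field; lra).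
  rewrite ED; apply Sym_eq; unfold sact, toSym, sscale; cbv [sA sB sC]; rewrite ?Ex, ?Ey.
  (* The squared modulus of [(a z + b) conj(c z + d)], whose imaginary part is [y] because the
     determinant is 1. *)
  - assert (HN : ((ma m * fst z + mb m) * (mc m * fst z + md m) + ma m * mc m * snd z ^ 2) ^ 2
            + snd z ^ 2 =
            ((ma m * fst z + mb m) ^ 2 + (ma m * snd z) ^ 2) * D).
    { transitivity (((ma m * fst z + mb m) * (mc m * fst z + md m) + ma m * mc m * snd z ^ 2) ^ 2
        + (ma m * md m - mb m * mc m) ^ 2 * snd z ^ 2);
      [rewrite Hm; ring | unfold D; ring]. }
    transitivity ((((ma m * fst z + mb m) * (mc m * fst z + md m) + ma m * mc m * snd z ^ 2) ^ 2
            + snd z ^ 2) / D); [rewrite HN; field; lra | field; lra].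
  - field; lra.
  - unfold D; ring.
Qed.

Lemma sact_Ide (m : Mat) (xi : option R) :
  inSL m -> exists j, j <> 0 /\ mv m (vec xi) = vscale j (vec (actB m xi)) /\
    sact m (toSym (Ide xi)) = sscale (j ^ 2) (toSym (Ide (actB m xi))).
Proof.
  intros Hm; destruct (mv_vec m xi Hm) as [j [Hj E]]; exists j; split; [exact Hj|]; split; [exact E|].
  rewrite (toSym_Ide xi xi), sact_comb, E.
  apply Sym_eq; unfold comb, vscale, sscale, toSym; simpl; ring.
Qed.

Lemma sact_toSym (m : Mat) (P : pt) :
  inSL m -> valid P -> exists J, J > 0 /\ sact m (toSym P) = sscale J (toSym (act m P)).
Proof.
  intros Hm HP; destruct P as [z|xi].
  - exists (snd z / snd (actH m z)); split; [|exact (sact_Int m z Hm HP)].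
    apply Rdiv_lt_0_compat; [exact HP | apply valid_actH; assumption].
  - destruct (sact_Ide m xi Hm) as [j [Hj [_ E]]]; exists (j ^ 2); split; [apply sq_pos; exact Hj | exact E].
Qed.

Lemma toSym_inj (P P' : pt) (r : R) :
  valid P -> valid P' -> toSym P = sscale r (toSym P') -> P = P'.
Proof.
  intros HP HP'; destruct P as [[x y]|[x|]], P' as [[x' y']|[x'|]];
    unfold toSym, sscale; simpl; simpl in HP, HP'; intros E; injection E; intros E1 E2 E3;
    try (exfalso; lra);
    try (exfalso; assert (Er : r = 0) by lra; subst r; lra);
    try (assert (Er : r = 1) by lra; subst r; assert (x = x') by lra; subst x').
  - assert (E4 : (y - y') * (y + y') = 0) by lra.
    apply Rmult_integral in E4; assert (y = y') by lra; subst; reflexivity.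
  - exfalso; generalize (sq_pos y (Rgt_not_eq _ _ HP)); lra.
  - exfalso; generalize (sq_pos y' (Rgt_not_eq _ _ HP')); lra.
  - reflexivity.
  - reflexivity.
Qed.

Lemma toSym_neq0 (P : pt) : ~ (sA (toSym P) = 0 /\ sB (toSym P) = 0 /\ sC (toSym P) = 0).
Proof. destruct P as [[x y]|[x|]]; simpl; lra. Qed.

Lemma sdet_Int (z : R * R) : sdet (toSym (Int z)) = snd z ^ 2.
Proof. unfold sdet; simpl; ring. Qed.

(** * Quadratic forms and coordinates relative to a geodesic line *)

(** The pairing of [X] with [u u^T]. For an interior point [z], the quotient of
    [qform (toSym (Int z)) u] by the height of [z] is the exponential of a Busemann function centred
    at the ideal point of [u]. *)
Definition qform (X : Sym) (u : R * R) : R :=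
  sA X * snd u ^ 2 - 2 * sB X * fst u * snd u + sC X * fst u ^ 2.

(** The polarisation of [qform]; it vanishes on the span of [u u^T] and [v v^T]. *)
Definition sform (u v : R * R) (X : Sym) : R :=
  sA X * snd u * snd v - sB X * (fst u * snd v + snd u * fst v) + sC X * fst u * fst v.

Lemma Sfun_sform (p q : option R) (P : pt) : Sfun p q P = sform (vec p) (vec q) (toSym P).
Proof.
  unfold Sfun, sform, toSym; destruct p as [a|], q as [b|], P as [[x y]|[x|]]; simpl; ring.
Qed.

Lemma sform_sact (m : Mat) (u v : R * R) (X : Sym) :
  inSL m -> sform (mv m u) (mv m v) (sact m X) = sform u v X.
Proof.
  unfold inSL; intros Hm.
  transitivity ((ma m * md m - mb m * mc m) ^ 2 * sform u v X);
    [unfold sform, sact, mv; simpl; ring | rewrite Hm; ring].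
Qed.

Lemma qform_sact (m : Mat) (u : R * R) (X : Sym) :
  inSL m -> qform (sact m X) (mv m u) = qform X u.
Proof.
  unfold inSL; intros Hm.
  transitivity ((ma m * md m - mb m * mc m) ^ 2 * qform X u);
    [unfold qform, sact, mv; simpl; ring | rewrite Hm; ring].
Qed.

Lemma sform_scale (j j' J : R) (u v : R * R) (X : Sym) :
  sform (vscale j u) (vscale j' v) (sscale J X) = j * j' * J * sform u v X.
Proof. unfold sform, vscale, sscale; simpl; ring. Qed.

Lemma qform_vscale (j : R) (u : R * R) (X : Sym) : qform X (vscale j u) = j ^ 2 * qform X u.
Proof. unfold qform, vscale; simpl; ring. Qed.

Lemma qform_sscale (j : R) (u : R * R) (X : Sym) : qform (sscale j X) u = j * qform X u.
Proof. unfold qform, sscale; simpl; ring. Qed.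

Lemma det2_vscale (j j' : R) (u v : R * R) :
  det2 (vscale j u) (vscale j' v) = j * j' * det2 u v.
Proof. unfold det2, vscale; simpl; ring. Qed.

Lemma sform_comb (u v u' v' : R * R) (a b c : R) :
  sform u v (comb u' v' a b c) =
    a * (det2 u u' * det2 v u') + c * (det2 u v' * det2 v v')
    + b * (det2 u u' * det2 v v' + det2 u v' * det2 v u').
Proof. unfold sform, comb, det2; simpl; ring. Qed.

Lemma qform_comb (u v w : R * R) (a b c : R) :
  qform (comb u v a b c) w =
    a * det2 u w ^ 2 + 2 * b * (det2 u w * det2 v w) + c * det2 v w ^ 2.
Proof. unfold qform, comb, det2; simpl; ring. Qed.

Lemma pairing_qform (X : Sym) (u v : R * R) : pairing (comb u v 1 0 0) X = qform X u.
Proof. unfold pairing, comb, qform; simpl; ring. Qed.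

Lemma sdet_comb (u v : R * R) (a b c : R) :
  sdet (comb u v a b c) = (a * c - b ^ 2) * det2 u v ^ 2.
Proof. unfold sdet, comb, det2; simpl; ring. Qed.

(** The matrices [u u^T], [u v^T + v u^T], [v v^T] form a basis, and evaluating the forms at [u] and
    [v] isolates the coefficients. *)
Lemma comb_decomp (u v : R * R) (X : Sym) :
  det2 u v <> 0 ->
  X = comb u v (qform X v / det2 u v ^ 2) (- sform u v X / det2 u v ^ 2)
               (qform X u / det2 u v ^ 2).
Proof.
  intros H; apply Sym_eq; unfold comb; simpl sA; simpl sB; simpl sC;
    unfold qform, sform, det2 in *; field; exact H.
Qed.

Lemma qform_toSym_nonneg (P : pt) (u : R * R) : 0 <= qform (toSym P) u.
Proof.
  destruct P as [[x y]|xi]; unfold qform; simpl sA; simpl sB; simpl sC.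
  - simpl fst; simpl snd.
    replace (_ + _) with ((x * snd u - fst u) ^ 2 + (y * snd u) ^ 2) by ring.
    generalize (pow2_ge_0 (x * snd u - fst u)) (pow2_ge_0 (y * snd u)); lra.
  - replace (_ + _) with ((fst (vec xi) * snd u - snd (vec xi) * fst u) ^ 2) by ring.
    apply pow2_ge_0.
Qed.

Lemma sdet_toSym_nonneg (P : pt) : 0 <= sdet (toSym P).
Proof.
  destruct P as [z|xi]; [rewrite sdet_Int; apply pow2_ge_0|].
  unfold sdet; simpl; lra.
Qed.

(** The outer coefficients are values of a nonnegative form. If both vanished, the nonnegative
    determinant would be [- b^2 d^2], forcing the matrix to be zero. The middle one records the side
    of the line. *)
Lemma toSym_comb (p q : option R) (P : pt) :
  p <> q -> exists a b c, toSym P = comb (vec p) (vec q) a b c /\ 0 <= a /\ 0 <= c /\ 0 < a + c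
     /\ Sfun p q P = - b * det2 (vec p) (vec q) ^ 2.
Proof.
  intros Hpq; assert (Hd := proj1 (det2_vec_neq0 p q) Hpq).
  assert (HD := sq_pos _ Hd).
  assert (E := comb_decomp (vec p) (vec q) (toSym P) Hd).
  set (d := det2 (vec p) (vec q)) in *.
  set (a := qform (toSym P) (vec q) / d ^ 2) in *.
  set (b := - sform (vec p) (vec q) (toSym P) / d ^ 2) in *.
  set (c := qform (toSym P) (vec p) / d ^ 2) in *.
  assert (Ha : 0 <= a).
  { apply Rmult_le_pos; [apply qform_toSym_nonneg | left; apply Rinv_0_lt_compat; exact HD]. }
  assert (Hc : 0 <= c).
  { apply Rmult_le_pos; [apply qform_toSym_nonneg | left; apply Rinv_0_lt_compat; exact HD]. }
  exists a, b, c; repeat split; try assumption.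
  - destruct (Rle_lt_dec (a + c) 0) as [H|H]; [exfalso | exact H].
    assert (Ea : a = 0) by lra; assert (Ec : c = 0) by lra.
    assert (Hs := sdet_toSym_nonneg P); rewrite E, sdet_comb, Ea, Ec in Hs; fold d in Hs.
    assert (Eb : b = 0).
    { destruct (Req_dec_T b 0) as [|Hb]; [assumption|].
      generalize (Rmult_lt_0_compat _ _ (sq_pos b Hb) HD); lra. }
    apply (toSym_neq0 P); rewrite E, Ea, Eb, Ec; unfold comb; simpl; lra.
  - rewrite Sfun_sform; unfold b; field; exact Hd.
Qed.

Lemma inClosure_iff (p q : option R) (P : pt) :
  p <> q -> (inClosure p q P <-> valid P /\ Sfun p q P = 0).
Proof.
  intros Hpq; destruct P as [z|xi].
  - simpl valid; unfold inClosure, onGeod, Sfun.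
    destruct p as [a|], q as [b|]; simpl; (split; intros [H1 H2]; split; [exact H1| |exact H1|]);
      try lra; congruence.
  - simpl valid; unfold inClosure; rewrite Sfun_sform; simpl toSym.
    assert (E : sform (vec p) (vec q) (toSym (Ide xi)) = det2 (vec p) (vec xi) * det2 (vec q) (vec xi))
      by (unfold sform, toSym, det2; simpl; ring).
    simpl toSym in E; rewrite E; split.
    + intros [-> | ->]; split; try exact I; unfold det2; ring.
    + intros [_ H]; apply Rmult_integral in H; destruct H as [H|H].
      * left; destruct (Req_dec_T (det2 (vec p) (vec xi)) 0); [|lra].
        destruct xi as [x|], p as [a|]; unfold det2 in H; simpl in H; try reflexivity; try lra.
        f_equal; lra.
      * right; destruct xi as [x|], q as [a|]; unfold det2 in H; simpl in H; try reflexivity; try lra.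
        f_equal; lra.
Qed.

Lemma inClosure_comb (p q : option R) (P : pt) :
  p <> q -> inClosure p q P ->
  exists a c, toSym P = comb (vec p) (vec q) a 0 c /\ 0 <= a /\ 0 <= c /\ 0 < a + c.
Proof.
  intros Hpq HP; apply (inClosure_iff p q P Hpq) in HP; destruct HP as [_ HS].
  destruct (toSym_comb p q P Hpq) as [a [b [c [E [Ha [Hc [Hac Hb]]]]]]].
  assert (Eb : b = 0).
  { rewrite HS in Hb.
    assert (Hb' : b * det2 (vec p) (vec q) ^ 2 = 0) by lra.
    apply Rmult_integral in Hb'; destruct Hb' as [|Hb']; [assumption|].
    generalize (sq_pos _ (proj1 (det2_vec_neq0 p q) Hpq)); lra. }
  rewrite Eb in E; exists a, c; auto.
Qed.

(** * Nonrepelling fixed points as eigenvectors with eigenvalue at least 1 *)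

Lemma isId_sact (h : Mat) (X : Sym) : isId h -> sact h X = X.
Proof.
  intros H; rewrite (sact_peq _ _ X H); apply Sym_eq; unfold sact; simpl; ring.
Qed.

(** An eigenvalue is a root of the characteristic polynomial: multiply [(h - j) w = 0] by the
    adjugate of [h - j]. *)
Lemma trace_Ide (h : Mat) (w : R * R) (j : R) :
  inSL h -> (fst w <> 0 \/ snd w <> 0) -> mv h w = vscale j w -> j * trace h = j ^ 2 + 1.
Proof.
  unfold inSL, mv, vscale, trace; intros Hh Hw E; injection E; intros E2 E1.
  assert (F1 : (j ^ 2 + 1 - j * (ma h + md h)) * fst w = 0).
  { assert ((ma h - j) * fst w + mb h * snd w = 0) by lra.
    assert (mc h * fst w + (md h - j) * snd w = 0) by lra.
    transitivity ((ma h * md h - mb h * mc h - j * (ma h + md h) + j ^ 2) * fst w).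
    { rewrite Hh; ring. }
    transitivity ((md h - j) * ((ma h - j) * fst w + mb h * snd w)
                  - mb h * (mc h * fst w + (md h - j) * snd w)); [ring|].
    rewrite H, H0; ring. }
  assert (F2 : (j ^ 2 + 1 - j * (ma h + md h)) * snd w = 0).
  { assert ((ma h - j) * fst w + mb h * snd w = 0) by lra.
    assert (mc h * fst w + (md h - j) * snd w = 0) by lra.
    transitivity ((ma h * md h - mb h * mc h - j * (ma h + md h) + j ^ 2) * snd w).
    { rewrite Hh; ring. }
    transitivity ((ma h - j) * (mc h * fst w + (md h - j) * snd w)
                  - mc h * ((ma h - j) * fst w + mb h * snd w)); [ring|].
    rewrite H, H0; ring. }
  apply Rmult_integral in F1; apply Rmult_integral in F2; lra.
Qed.

Lemma vec_neq0 (xi : option R) : fst (vec xi) <> 0 \/ snd (vec xi) <> 0.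
Proof. destruct xi; simpl; [right | left]; lra. Qed.

Lemma fixed_Ide (h : Mat) (xi : option R) (j : R) :
  inSL h -> mv h (vec xi) = vscale j (vec (actB h xi)) -> actB h xi = xi ->
  j * trace h = j ^ 2 + 1 /\ (attracting h xi <-> Rabs j > 1).
Proof.
  intros Hh E Hfix; rewrite Hfix in E; split; [exact (trace_Ide h _ j Hh (vec_neq0 xi) E)|].
  destruct xi as [x|]; unfold attracting; injection E; simpl; intros E2 E1.
  - replace (mc h * x + md h) with j by lra; tauto.
  - replace (ma h) with j by lra; tauto.
Qed.

(** Since the height of [z] is preserved, [|c z + d| = 1]. The real part of [c z + d] is half the
    trace and its imaginary part is [c y], so the trace is less than 2 in absolute value unless
    [c = 0], and then [h] is the identity. *)
Lemma trace_elliptic (h : Mat) (z : R * R) :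
  inSL h -> snd z > 0 -> actH h z = z -> isId h \/ elliptic h.
Proof.
  intros Hh Hz Hfix.
  assert (E := sact_Int h z Hh Hz); rewrite Hfix in E.
  replace (snd z / snd z) with 1 in E by (field; lra).
  rewrite sscale_1 in E; destruct z as [x y]; unfold sact, toSym in E; simpl fst in *; simpl snd in *.
  injection E; intros E3 E2 E1.
  unfold inSL in Hh.
  destruct (Req_dec_T (mc h) 0) as [Hc|Hc].
  - left; unfold isId, peq, mopp; simpl.
    rewrite Hc in *.
    assert (Hd : (md h - 1) * (md h + 1) = 0) by lra.
    apply Rmult_integral in Hd; destruct Hd as [Hd|Hd].
    + assert (Hd' : md h = 1) by lra; rewrite Hd' in *.
      assert (Ha : ma h = 1) by lra; rewrite Ha in *.
      left; apply Mat_eq; simpl; lra.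
    + assert (Hd' : md h = - 1) by lra; rewrite Hd' in *.
      assert (Ha : ma h = - 1) by lra; rewrite Ha in *.
      right; apply Mat_eq; simpl; lra.
  - right.
    assert (Hcy0 : mc h * y <> 0).
    { apply Rmult_integral_contrapositive; split; [exact Hc | apply Rgt_not_eq; exact Hz]. }
    assert (Hcy := sq_pos _ Hcy0).
    (* This says that the real part of [z] is [(a - d) / (2 c)], half the sum of the roots of
       [c z^2 + (d - a) z - b]. *)
    assert (Et : mc h * x + md h = trace h / 2).
    { assert (G : mc h * x = ma h - mc h * x - md h); [|unfold trace; lra].
      assert (E3' : mc h ^ 2 * (x ^ 2 + y ^ 2) + 2 * mc h * md h * x + md h ^ 2 * 1 = 1) by lra.
      rewrite <- E2 at 1.
      transitivity (ma h * (mc h ^ 2 * (x ^ 2 + y ^ 2) + 2 * mc h * md h * x + md h ^ 2 * 1)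
        - (mc h * x + md h) * (ma h * md h - mb h * mc h)); [ring | rewrite E3', Hh; ring]. }
    unfold elliptic.
    assert (trace h ^ 2 < 4).
    { assert ((trace h / 2) ^ 2 + (mc h * y) ^ 2 = 1) by (rewrite <- Et; lra). lra. }
    apply Rabs_def1; nra.
Qed.

Lemma act_fixed_of_sact (h : Mat) (P : pt) (l : R) :
  inSL h -> valid P -> sact h (toSym P) = sscale l (toSym P) -> act h P = P.
Proof.
  intros Hh HP E; destruct (sact_toSym h P Hh HP) as [J [HJ EJ]].
  apply (toSym_inj _ _ (l / J) (valid_act h P Hh HP) HP).
  transitivity (sscale (1 / J) (sscale J (toSym (act h P)))).
  - rewrite sscale_sscale; replace (1 / J * J) with 1 by (field; lra); symmetry; apply sscale_1.
  - rewrite <- EJ, E, sscale_sscale; f_equal; field; lra.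
Qed.

Lemma sscale_toSym_inj (P : pt) (r s : R) : sscale r (toSym P) = sscale s (toSym P) -> r = s.
Proof.
  intros E; destruct (Req_dec_T r s) as [|H]; [assumption | exfalso].
  apply (toSym_neq0 P); unfold sscale in E; injection E; intros E3 E2 E1.
  assert (F : forall t, r * t = s * t -> t = 0).
  { intros t Et; assert (Ht : (r - s) * t = 0) by lra.
    apply Rmult_integral in Ht; destruct Ht; lra. }
  auto.
Qed.

(** At an ideal fixed point the factor is [j^2] for an eigenvalue [j] with [j * trace h = j^2 + 1].
    Thus [|j| = 1] corresponds to trace of absolute value 2, and [|j| > 1] to an attracting point of
    a hyperbolic element. At an interior fixed point the factor is 1. *)
Lemma nonrep_iff (h : Mat) (P : pt) :
  inSL h ->
  (nonrep h P <-> valid P /\ exists l, 1 <= l /\ sact h (toSym P) = sscale l (toSym P)).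
Proof.
  intros Hh; split.
  - intros [HP H]; split; [exact HP|]; destruct H as [H | [[_ [[z ->] H]] | [[[Ht _] [[xi ->] H]] | [Ht [xi [-> [H Ha]]]]]]].
    + exists 1; split; [lra|]; rewrite sscale_1; apply isId_sact; exact H.
    + exists 1; split; [lra|].
      injection H; intros H'; rewrite (sact_Int h z Hh HP), H'.
      f_equal; field; simpl in HP; lra.
    + injection H; intros H'; destruct (sact_Ide h xi Hh) as [j [Hj [E1 E2]]].
      destruct (fixed_Ide h xi j Hh E1 H') as [Htr _].
      exists (j ^ 2); split; [|rewrite E2, H'; reflexivity].
      unfold Rabs in Ht; destruct (Rcase_abs (trace h)).
      * assert (Et : trace h = - 2) by lra; rewrite Et in Htr; nra.
      * rewrite Ht in Htr; nra.
    + destruct (sact_Ide h xi Hh) as [j [Hj [E1 E2]]].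
      destruct (fixed_Ide h xi j Hh E1 H) as [_ Hat]; apply Hat in Ha.
      exists (j ^ 2); split; [|rewrite E2, H; reflexivity].
      rewrite <- (pow2_abs j); nra.
  - intros [HP [l [Hl E]]]; split; [exact HP|].
    assert (Hfix := act_fixed_of_sact h P l Hh HP E).
    destruct P as [z|xi].
    + injection Hfix; intros Hz; destruct (trace_elliptic h z Hh HP Hz) as [Hi|He]; [tauto|].
      right; left; eauto.
    + injection Hfix; intros Hxi; destruct (sact_Ide h xi Hh) as [j [Hj [E1 E2]]].
      destruct (fixed_Ide h xi j Hh E1 Hxi) as [Htr Hat].
      rewrite Hxi, E in E2; apply sscale_toSym_inj in E2.
      destruct (classic (isId h)) as [Hi|Hi]; [tauto|].
      right; right.
      assert (Hj1 : Rabs j >= 1) by (rewrite <- (pow2_abs j) in E2; generalize (Rabs_pos j); nra).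
      assert (Hja : Rabs j * Rabs (trace h) = Rabs j ^ 2 + 1).
      { rewrite <- Rabs_mult, Htr, pow2_abs, Rabs_right; [reflexivity | nra]. }
      destruct (Req_dec_T (Rabs j) 1) as [H1|H1].
      * left; split; [|eauto]; split; [|exact Hi]; rewrite H1 in Hja; lra.
      * right; split; [|exists xi; split; [reflexivity|]; split; [exact Hxi|]; apply Hat; lra].
        unfold hyperbolic; nra.
Qed.

(** * Distances *)

(** The exponential of [arcosh t] is the larger root of [e^2 - 2 t e + 1]; distances are compared
    through this equation. *)
Lemma exp_arcosh (t : R) : 1 <= t ->
  1 <= exp (arcosh t) /\ exp (arcosh t) ^ 2 + 1 = 2 * t * exp (arcosh t).
Proof.
  intros Ht; unfold arcosh; assert (H0 : 0 <= t ^ 2 - 1) by nra.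
  assert (Hs := sqrt_pos (t ^ 2 - 1)); assert (Hq := sqrt_sqrt _ H0).
  rewrite exp_ln by lra; nra.
Qed.

(* [e + 1 / e] is injective on [1, oo). *)
Lemma arcosh_eq_ln (t e : R) : 1 <= e -> e ^ 2 + 1 = 2 * t * e -> arcosh t = ln e.
Proof.
  intros He E; assert (Ht : 1 <= t) by nra.
  destruct (exp_arcosh t Ht) as [H1 H2]; set (f := exp (arcosh t)) in *.
  assert (Hf : f = e).
  { assert (F : (f - e) * (f * e - 1) = 0).
    { transitivity (e * (f ^ 2 + 1) - f * (e ^ 2 + 1)); [ring|]; rewrite H2, E; ring. }
    apply Rmult_integral in F; destruct F as [F|F]; [lra|]; nra. }
  rewrite <- Hf; unfold f; symmetry; apply ln_exp.
Qed.

Lemma arcosh_nonneg (t : R) : 1 <= t -> 0 <= arcosh t.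
Proof.
  intros Ht; destruct (exp_arcosh t Ht) as [H _].
  destruct (Rle_lt_dec 0 (arcosh t)) as [|Hn]; [assumption|].
  apply exp_increasing in Hn; rewrite exp_0 in Hn; lra.
Qed.

(** The hyperbolic cosine of the distance: half the pairing after both matrices are scaled to
    determinant 1. *)
Definition chd (z w : R * R) : R :=
  pairing (toSym (Int z)) (toSym (Int w)) / (2 * snd z * snd w).

Lemma dH_chd (z w : R * R) : snd z > 0 -> snd w > 0 -> dH z w = arcosh (chd z w) /\ 1 <= chd z w.
Proof.
  intros Hz Hw; assert (E : 1 + ((fst z - fst w) ^ 2 + (snd z - snd w) ^ 2) / (2 * snd z * snd w) = chd z w).
  { unfold chd, pairing; simpl; field; lra. }
  split; [unfold dH; rewrite E; reflexivity|].
  rewrite <- E.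
  assert (0 <= ((fst z - fst w) ^ 2 + (snd z - snd w) ^ 2) / (2 * snd z * snd w)); [|lra].
  apply Rmult_le_pos; [generalize (pow2_ge_0 (fst z - fst w)) (pow2_ge_0 (snd z - snd w)); lra|].
  left; apply Rinv_0_lt_compat; nra.
Qed.

Lemma chd_act (g g' : Mat) (z w : R * R) : inSL g -> inSL g' -> snd z > 0 -> snd w > 0 ->
  chd (actH g z) (actH g' w) =
    pairing (sact g (toSym (Int z))) (sact g' (toSym (Int w))) / (2 * snd z * snd w).
Proof.
  intros Hg Hg' Hz Hw.
  rewrite (sact_Int g z Hg Hz), (sact_Int g' w Hg' Hw), pairing_sscale.
  assert (H1 := valid_actH g z Hg Hz); assert (H2 := valid_actH g' w Hg' Hw).
  unfold chd; field; lra.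
Qed.

Lemma ln_mono (x y : R) : 0 < x -> x <= y -> ln x <= ln y.
Proof.
  intros Hx [H|H]; [left; apply ln_increasing; assumption | rewrite H; lra].
Qed.

(** As [lam >= 1], the root [sqrt (c'^2 - 1)] is at least [lam * sqrt (c^2 - 1)], so the argument of
    the logarithm grows by the factor [lam] at least. *)
Lemma arcosh_gap (c c' lam : R) : 1 <= c -> 1 <= lam -> lam * c <= c' ->
  arcosh c' - arcosh c >= ln lam.
Proof.
  intros Hc Hl H; unfold arcosh.
  assert (H0 : 0 <= c ^ 2 - 1) by nra.
  assert (Hs := sqrt_pos (c ^ 2 - 1)).
  assert (Hm : lam * sqrt (c ^ 2 - 1) <= sqrt (c' ^ 2 - 1)).
  { rewrite <- (sqrt_pow2 lam) at 1 by lra; rewrite <- sqrt_mult by (try apply pow2_ge_0; lra).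
    apply sqrt_le_1_alt.
    assert (0 <= lam * c) by nra; nra. }
  assert (ln (lam * (c + sqrt (c ^ 2 - 1))) <= ln (c' + sqrt (c' ^ 2 - 1))).
  { apply ln_mono; [|lra]; apply Rmult_lt_0_compat; lra. }
  rewrite ln_mult in H1 by lra; lra.
Qed.

(* The inequalities are read off [exp (arcosh c) <= 2 c] and [2 c - 1 <= exp (arcosh c)]. *)
Lemma arcosh_gap_inv (c c' K : R) : 1 <= c -> 1 <= c' -> K > 0 -> arcosh c' - arcosh c >= K ->
  exp K * (2 * c - 1) <= 2 * c' /\ exp K + exp (- K) <= 2 * c'.
Proof.
  intros Hc Hc' HK H.
  destruct (exp_arcosh c Hc) as [H1 H2]; destruct (exp_arcosh c' Hc') as [H1' H2'].
  assert (Hle : exp K * exp (arcosh c) <= exp (arcosh c')).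
  { rewrite <- exp_plus; destruct (Rle_lt_or_eq_dec (K + arcosh c) (arcosh c')) as [Hlt|Heq]; [lra| |].
    - left; apply exp_increasing; exact Hlt.
    - rewrite Heq; lra. }
  assert (HK1 : 1 < exp K) by (rewrite <- exp_0; apply exp_increasing; lra).
  assert (HKi : exp K * exp (- K) = 1) by (rewrite <- exp_plus, Rplus_opp_r; apply exp_0).
  set (e := exp (arcosh c)) in *; set (e' := exp (arcosh c')) in *; set (k := exp K) in *.
  split.
  - assert (2 * c - 1 <= e) by nra.
    assert (e' <= 2 * c') by nra.
    nra.
  (* Since [e >= 1], the gap gives [k <= e'], and [x + 1 / x] increases on [1, oo). *)
  - assert (Hk : k <= e') by nra.
    assert (E' : 2 * c' = e' + / e') by (apply (Rmult_eq_reg_r e'); [field_simplify; [lra | lra] | lra]).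
    assert (E'' : exp (- K) = / k) by (apply Rmult_eq_reg_l with k; [rewrite HKi; field; lra | lra]).
    rewrite E', E''.
    assert (k + / k <= e' + / e'); [|lra].
    assert (G : e' + / e' - (k + / k) = (e' - k) * (1 - / (e' * k))) by (field; lra).
    assert (/ (e' * k) <= 1) by (rewrite <- Rinv_1; apply Rinv_le_contravar; nra).
    nra.
Qed.

(** * Horoballs *)

(** Unlike [horo], this takes an arbitrary coordinate vector of the centre. Without renormalisation
    an isometry just moves [w] and keeps the size [s]. *)
Definition horoball (w : R * R) (s : R) (z : R * R) : Prop :=
  snd z > 0 /\ qform (toSym (Int z)) w < s * snd z.

Lemma horo_iff (xi : option R) (s : R) (z : R * R) : horo xi s z <-> horoball (vec xi) s z.
Proof.
  unfold horo, horoball, qform; destruct xi as [a|]; simpl; split; intros [H1 H2]; split; lra.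
Qed.

Lemma actH_minv (g : Mat) (z : R * R) : inSL g -> snd z > 0 -> actH g (actH (minv g) z) = z.
Proof.
  intros Hg Hz; assert (Hi := inSL_minv g Hg).
  assert (Hv := valid_actH _ z Hi Hz).
  assert (E : Int (actH g (actH (minv g) z)) = Int z); [|injection E; auto].
  assert (Hv' := valid_actH g _ Hg Hv).
  assert (E1 := sact_Int (minv g) z Hi Hz).
  assert (E2 := sact_Int g _ Hg Hv).
  apply (f_equal (sact g)) in E1; rewrite sact_sscale, E2, sscale_sscale in E1.
  assert (E3 : sact g (sact (minv g) (toSym (Int z))) = toSym (Int z)).
  { rewrite <- (sact_minv (minv g)) by exact Hi; f_equal.
    destruct g; unfold minv; simpl; f_equal; ring. }
  rewrite E3 in E1.
  symmetry; eapply toSym_inj; [exact Hz | exact Hv' | exact E1].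
Qed.

Lemma imgSet_horo (g : Mat) (xi : option R) (s : R) (z : R * R) :
  inSL g -> (imgSet g (horo xi s) z <-> horoball (mv g (vec xi)) s z).
Proof.
  intros Hg.
  assert (Himg : forall z0, snd z0 > 0 ->
    (horoball (vec xi) s z0 <-> horoball (mv g (vec xi)) s (actH g z0))).
  { intros z0 H0; assert (H1 := valid_actH g z0 Hg H0).
    assert (E := qform_sact g (vec xi) (toSym (Int z0)) Hg).
    rewrite (sact_Int g z0 Hg H0), qform_sscale in E.
    unfold horoball; rewrite <- E.
    set (q := qform (toSym (Int (actH g z0))) (mv g (vec xi))).
    set (y0 := snd z0) in *; set (y := snd (actH g z0)) in *.
    assert (Hr : 0 < y0 / y) by (apply Rdiv_lt_0_compat; lra).
    assert (Er : y0 = y0 / y * y) by (field; lra).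
    split; intros [_ H]; split; try assumption.
    - apply (Rmult_lt_reg_l (y0 / y)); [exact Hr|]; rewrite Er in H at 2; lra.
    - apply (Rmult_lt_compat_l (y0 / y)) in H; [|exact Hr]; rewrite Er at 2; lra. }
  split.
  - intros [z0 [H0 <-]]; apply horo_iff in H0; apply Himg; [apply H0 | exact H0].
  - intros H; exists (actH (minv g) z).
    assert (Hz := proj1 H); assert (E := actH_minv g z Hg Hz).
    split; [|exact E].
    apply horo_iff, Himg; [apply valid_actH; [apply inSL_minv; exact Hg | exact Hz]|].
    rewrite E; exact H.
Qed.

Lemma setdist_ext (A A' B B' : R * R -> Prop) (r : R) :
  (forall z, A z <-> A' z) -> (forall z, B z <-> B' z) -> setdist A B r -> setdist A' B' r.
Proof.
  intros HA HB [H1 H2]; split.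
  - intros u v Hu Hv; apply H1; [apply HA | apply HB]; assumption.
  - intros r' Hr'; apply H2; intros u v Hu Hv; apply Hr'; [apply HA | apply HB]; assumption.
Qed.

Lemma setdist_unique (A B : R * R -> Prop) (r r' : R) : setdist A B r -> setdist A B r' -> r = r'.
Proof. intros [H1 H2] [H1' H2']; apply Rle_antisym; auto. Qed.

Lemma point_of_sym (X : Sym) : sdet X = 1 -> sC X > 0 ->
  exists z, snd z > 0 /\ toSym (Int z) = sscale (snd z) X.
Proof.
  intros HX HC; exists (sB X / sC X, / sC X); simpl snd; split.
  - apply Rinv_0_lt_compat; exact HC.
  - apply Sym_eq; unfold toSym, sscale; cbv [sA sB sC fst snd]; fold (sA X) (sB X) (sC X).
    + assert (EA : sA X = (1 + sB X ^ 2) / sC X).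
      { rewrite <- HX; unfold sdet; field; lra. }
      rewrite EA; field; lra.
    + field; lra.
    + field; lra.
Qed.

Lemma sC_comb_pos (u v : R * R) (a c : R) : 0 < a -> 0 < c -> det2 u v <> 0 ->
  sC (comb u v a 0 c) > 0.
Proof.
  intros Ha Hc Hd; unfold comb; simpl sC.
  assert (H : snd u <> 0 \/ snd v <> 0).
  { destruct (Req_dec_T (snd u) 0) as [H1|]; [|tauto].
    destruct (Req_dec_T (snd v) 0) as [H2|]; [|tauto].
    exfalso; apply Hd; unfold det2; rewrite H1, H2; ring. }
  assert (H1 := pow2_ge_0 (snd u)); assert (H2 := pow2_ge_0 (snd v)).
  destruct H as [H|H]; apply sq_pos in H; nra.
Qed.

(* The difference of the two sides is the squared determinant of the triple
   formed by [X], [X'] and the rank-one matrix of [w]. *)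
Lemma gram_null (X X' : Sym) (w : R * R) :
  sdet X' * qform X w ^ 2 + sdet X * qform X' w ^ 2 <= pairing X X' * (qform X w * qform X' w).
Proof.
  assert (E : pairing X X' * (qform X w * qform X' w)
     - (sdet X' * qform X w ^ 2 + sdet X * qform X' w ^ 2) =
     (sA X * (sB X' * snd w ^ 2 - sC X' * (fst w * snd w))
      - sB X * (sA X' * snd w ^ 2 - sC X' * fst w ^ 2)
      + sC X * (sA X' * (fst w * snd w) - sB X' * fst w ^ 2)) ^ 2).
  { unfold pairing, qform, sdet; ring. }
  generalize (pow2_ge_0 (sA X * (sB X' * snd w ^ 2 - sC X' * (fst w * snd w))
      - sB X * (sA X' * snd w ^ 2 - sC X' * fst w ^ 2)
      + sC X * (sA X' * (fst w * snd w) - sB X' * fst w ^ 2))); lra.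
Qed.

(** The difference is the square of [sform w w' X]. For interior points this bounds below the sum of
    the Busemann functions at two centres. *)
Lemma qform_mult_ge (X : Sym) (w w' : R * R) :
  sdet X * det2 w w' ^ 2 <= qform X w * qform X w'.
Proof.
  assert (E : qform X w * qform X w' - sdet X * det2 w w' ^ 2 = sform w w' X ^ 2)
    by (unfold qform, sform, sdet, det2; ring).
  generalize (pow2_ge_0 (sform w w' X)); lra.
Qed.

(* Busemann functions are 1-Lipschitz. *)
Lemma qform_lipschitz (z z' w : R * R) : snd z > 0 -> snd z' > 0 ->
  qform (toSym (Int z')) w / snd z' <= exp (dH z z') * (qform (toSym (Int z)) w / snd z).
Proof.
  intros Hz Hz'; destruct (dH_chd z z' Hz Hz') as [-> Ht].
  destruct (exp_arcosh _ Ht) as [He E]; set (e := exp (arcosh (chd z z'))) in *.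
  assert (G := gram_null (toSym (Int z)) (toSym (Int z')) w).
  rewrite !sdet_Int in G.
  assert (P0 := qform_toSym_nonneg (Int z) w); assert (P1 := qform_toSym_nonneg (Int z') w).
  assert (Hp : pairing (toSym (Int z)) (toSym (Int z')) = 2 * chd z z' * snd z * snd z')
    by (unfold chd; field; lra).
  rewrite Hp in G.
  set (q := qform (toSym (Int z)) w) in *; set (q' := qform (toSym (Int z')) w) in *.
  set (y := snd z) in *; set (y' := snd z') in *.
  set (a := q / y); set (b := q' / y').
  assert (Ea : q = a * y) by (unfold a; field; lra).
  assert (Eb : q' = b * y') by (unfold b; field; lra).
  assert (Ha : 0 <= a) by (apply Rmult_le_pos; [exact P0 | left; apply Rinv_0_lt_compat; lra]).
  assert (Hb : 0 <= b) by (apply Rmult_le_pos; [exact P1 | left; apply Rinv_0_lt_compat; lra]).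
  rewrite Ea, Eb in G.
  assert (G' : a ^ 2 + b ^ 2 <= 2 * chd z z' * (a * b)).
  { apply (Rmult_le_reg_l ((y * y') ^ 2)); [apply sq_pos; nra|]; lra. }
  destruct (Rle_lt_dec b (e * a)) as [|Hlt]; [assumption | exfalso].
  (* Because [e + 1 / e] is twice [chd z z'], the quadratic inequality [G'] factors. *)
  assert (Hx : (b - e * a) * (e * b - a) <= 0).
  { assert (F : (b - e * a) * (e * b - a) = e * (a ^ 2 + b ^ 2) - (e ^ 2 + 1) * (a * b)) by ring.
    rewrite F, E.
    apply (Rmult_le_compat_l e) in G'; lra. }
  assert (Hlt' : 0 < e * b - a) by nra.
  assert (0 < (b - e * a) * (e * b - a)) by (apply Rmult_lt_0_compat; lra).
  lra.
Qed.

(** Lower bound: [qform_lipschitz] transports the value at [w] from [z] to [z'], where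
    [qform_mult_ge] applies. Sharpness: points on the geodesic joining the centres, slightly inside
    the open horoballs. *)
Lemma setdist_horoball (w w' : R * R) (s s' : R) :
  0 < s -> 0 < s' -> s * s' <= det2 w w' ^ 2 ->
  setdist (horoball w s) (horoball w' s') (ln (det2 w w' ^ 2) - ln (s * s')).
Proof.
  intros Hs Hs' Hss; assert (Hp : 0 < s * s') by nra.
  set (m := det2 w w' ^ 2) in *.
  assert (Hd : det2 w w' <> 0) by (intros E; unfold m in Hss; rewrite E in Hss; lra).
  split.
  - intros z z' [Hz Hq] [Hz' Hq'].
    assert (L := qform_lipschitz z z' w Hz Hz').
    assert (G := qform_mult_ge (toSym (Int z')) w w'); rewrite sdet_Int in G; fold m in G.
    assert (P0 := qform_toSym_nonneg (Int z) w); assert (P2 := qform_toSym_nonneg (Int z') w').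
    set (e := exp (dH z z')) in *; assert (He : 0 < e) by apply exp_pos.
    set (a := qform (toSym (Int z)) w / snd z) in *.
    set (b := qform (toSym (Int z')) w / snd z') in *.
    set (b' := qform (toSym (Int z')) w' / snd z').
    assert (Ha : a < s).
    { apply (Rmult_lt_reg_r (snd z)); [exact Hz|]; unfold a; field_simplify; lra. }
    assert (Hb' : b' < s').
    { apply (Rmult_lt_reg_r (snd z')); [exact Hz'|]; unfold b'; field_simplify; lra. }
    assert (Ha0 : 0 <= a) by (apply Rmult_le_pos; [exact P0 | left; apply Rinv_0_lt_compat; lra]).
    assert (Hb0 : 0 <= b') by (apply Rmult_le_pos; [exact P2 | left; apply Rinv_0_lt_compat; lra]).
    assert (Hm : m <= b * b').
    { apply (Rmult_le_reg_l (snd z' ^ 2)); [apply sq_pos; lra|].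
      unfold b, b'; field_simplify; lra. }
    assert (Hfin : m <= e * (s * s')).
    { apply Rle_trans with (1 := Hm).
      apply Rle_trans with (e * a * b'); [apply Rmult_le_compat_r; assumption|].
      rewrite Rmult_assoc; apply Rmult_le_compat_l; [lra|]; apply Rmult_le_compat; lra. }
    apply ln_mono in Hfin; [|lra].
    rewrite ln_mult in Hfin by lra; unfold e in Hfin; rewrite ln_exp in Hfin; lra.
  - intros r' Hr'.
    destruct (Rle_lt_dec r' (ln m - ln (s * s'))) as [|Hlt]; [assumption | exfalso].
    set (eta := r' - (ln m - ln (s * s'))).
    (* Shrinking both sizes by [th] adds [eta / 2] to the distance, which is still less than
       [eta]. *)
    set (th := exp (- eta / 4)).
    assert (Hth : 0 < th < 1).
    { split; [apply exp_pos|]; rewrite <- exp_0; apply exp_increasing; unfold eta; lra. }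
    assert (Hm : 0 < m) by lra.
    assert (H1 : 0 < th * s) by nra; assert (H1' : 0 < th * s') by nra.
    set (s1 := th * s) in *; set (s1' := th * s') in *.
    assert (H2 : s1 * s1' <= m).
    { unfold s1, s1'; assert (th * th * (s * s') <= 1 * (s * s')) by (apply Rmult_le_compat_r; nra); lra. }
    assert (I1 : 0 < / s1) by (apply Rinv_0_lt_compat; lra).
    assert (I1' : 0 < / s1') by (apply Rinv_0_lt_compat; lra).
    assert (I2 : 0 < s1 / m) by (apply Rdiv_lt_0_compat; lra).
    assert (I2' : 0 < s1' / m) by (apply Rdiv_lt_0_compat; lra).
    (* The points where the geodesic between the centres crosses the horocycles of sizes [s1] and
       [s1']. *)
    destruct (point_of_sym (comb w w' (/ s1) 0 (s1 / m))) as [z [Hz Ez]].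
    { rewrite sdet_comb; fold m; field; lra. }
    { apply sC_comb_pos; assumption. }
    destruct (point_of_sym (comb w w' (s1' / m) 0 (/ s1'))) as [z' [Hz' Ez']].
    { rewrite sdet_comb; fold m; field; lra. }
    { apply sC_comb_pos; assumption. }
    assert (Dw : det2 w w = 0) by (unfold det2; ring).
    assert (Dw' : det2 w' w' = 0) by (unfold det2; ring).
    assert (Dm : det2 w' w ^ 2 = m) by (unfold m, det2; ring).
    assert (Hz1 : horoball w s z).
    { split; [exact Hz|]; rewrite Ez, qform_sscale, qform_comb, Dw, Dm.
      assert (s1 < s) by (unfold s1; nra).
      replace (_ * _) with (s1 * snd z) by (field; lra); nra. }
    assert (Hz1' : horoball w' s' z').
    { split; [exact Hz'|]; rewrite Ez', qform_sscale, qform_comb, Dw'; fold m.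
      assert (s1' < s') by (unfold s1'; nra).
      replace (_ * _) with (s1' * snd z') by (field; lra); nra. }
    assert (F := Hr' z z' Hz1 Hz1').
    destruct (dH_chd z z' Hz Hz') as [Edist _]; rewrite Edist in F.
    assert (He : 1 <= m / (s1 * s1')).
    { apply (Rmult_le_reg_r (s1 * s1')); [nra|]; field_simplify; lra. }
    rewrite (arcosh_eq_ln _ (m / (s1 * s1')) He) in F.
    + unfold Rdiv in F; rewrite ln_mult in F; [|lra|apply Rinv_0_lt_compat; nra].
      rewrite ln_Rinv in F by nra.
      replace (s1 * s1') with (th * th * (s * s')) in F by (unfold s1, s1'; ring).
      rewrite ln_mult, ln_mult in F by nra.
      unfold th in F; rewrite ln_exp in F; unfold eta in F; lra.
    + unfold chd; rewrite Ez, Ez', pairing_sscale, pairing_comb, Dw, Dw', Dm; fold m.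
      field; lra.
Qed.

(** Each finite distance is the logarithm of a squared determinant minus [ln (s * s')]. The sizes
    cancel, leaving [ln (N^2) - ln (M^2)]. When [M = 0] the original horoballs are concentric, and
    the value is [PInf] if [N <> 0]. *)
Lemma Fpos_iff (g g' : Mat) (xi xi' : option R) : inSL g -> inSL g' ->
  (actB g xi <> actB g' xi' /\ Fpos g g' xi xi' <->
   det2 (vec xi) (vec xi') ^ 2 < det2 (mv g (vec xi)) (mv g' (vec xi')) ^ 2).
Proof.
  intros Hg Hg'.
  set (M := det2 (vec xi) (vec xi')); set (N := det2 (mv g (vec xi)) (mv g' (vec xi'))).
  assert (HN : actB g xi <> actB g' xi' <-> N <> 0).
  { destruct (mv_vec g xi Hg) as [j [Hj E]]; destruct (mv_vec g' xi' Hg') as [j' [Hj' E']].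
    unfold N; rewrite E, E', det2_vscale, det2_vec_neq0.
    split; intros H.
    - apply Rmult_integral_contrapositive; split; [|exact H].
      apply Rmult_integral_contrapositive; tauto.
    - intros E0; apply H; rewrite E0; ring. }
  assert (HM : xi <> xi' <-> M <> 0) by apply det2_vec_neq0.
  assert (D1 : forall s s', 0 < s -> 0 < s' -> s * s' <= N ^ 2 ->
     setdist (imgSet g (horo xi s)) (imgSet g' (horo xi' s')) (ln (N ^ 2) - ln (s * s'))).
  { intros s s' Hs Hs' H.
    apply (setdist_ext (horoball (mv g (vec xi)) s) _ (horoball (mv g' (vec xi')) s') _);
      [intros z; symmetry; apply imgSet_horo; assumption
      |intros z; symmetry; apply imgSet_horo; assumption
      |apply setdist_horoball; assumption]. }
  assert (D2 : forall s s', 0 < s -> 0 < s' -> s * s' <= M ^ 2 ->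
     setdist (horo xi s) (horo xi' s') (ln (M ^ 2) - ln (s * s'))).
  { intros s s' Hs Hs' H.
    apply (setdist_ext (horoball (vec xi) s) _ (horoball (vec xi') s') _);
      [intros z; symmetry; apply horo_iff
      |intros z; symmetry; apply horo_iff
      |apply setdist_horoball; assumption]. }
  clearbody M N; split.
  - intros [Hne [v [[s0 [Hs0 HF]] Hv]]].
    assert (HN' := proj1 HN Hne).
    destruct (Req_dec_T M 0) as [E|E]; [rewrite E; generalize (sq_pos N HN'); lra|].
    assert (HNs := sq_pos N HN'); assert (HMs := sq_pos M E).
    assert (HNa := Rabs_pos_lt N HN'); assert (HMa := Rabs_pos_lt M E).
    rewrite <- (pow2_abs N), <- (pow2_abs M) in *.
    (* A common size admissible for [Fval] and small enough for both distance formulas. *)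
    set (s := Rmin s0 (Rmin (Rabs N) (Rabs M))).
    assert (Hs : 0 < s) by (unfold s; repeat apply Rmin_glb_lt; assumption).
    assert (Hss0 : s <= s0) by apply Rmin_l.
    assert (HsN : s <= Rabs N) by (eapply Rle_trans; [apply Rmin_r | apply Rmin_l]).
    assert (HsM : s <= Rabs M) by (eapply Rle_trans; [apply Rmin_r | apply Rmin_r]).
    destruct (HF s s (conj Hs Hss0) (conj Hs Hss0)) as [v1 [v2 [H1 [H2 H3]]]].
    destruct H1 as [[H1 _]|[_ [r1 [-> H1]]]]; [contradiction|].
    destruct H2 as [[H2 _]|[_ [r2 [-> H2]]]]; [exfalso; apply (proj2 HM E); exact H2|].
    apply (setdist_unique _ _ _ _ (D1 s s Hs Hs ltac:(nra))) in H1.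
    apply (setdist_unique _ _ _ _ (D2 s s Hs Hs ltac:(nra))) in H2.
    subst; simpl in Hv.
    apply ln_lt_inv; try assumption; simpl in *; lra.
  - intros Hlt; assert (HN' : N <> 0) by (intros ->; generalize (pow2_ge_0 M); lra).
    assert (Hne := proj2 HN HN'); split; [exact Hne|].
    destruct (Req_dec_T M 0) as [E|E].
    + exists PInf; split; [|exact I]; exists (Rabs N); split; [apply Rabs_pos_lt; exact HN'|].
      intros s s' Hs Hs'; exists (Fin (ln (N ^ 2) - ln (s * s'))), MInf; split; [|split].
      * right; split; [exact Hne|]; eexists; split; [reflexivity|].
        apply D1; [lra | lra | rewrite <- pow2_abs; nra].
      * left; split; [|reflexivity].
        destruct (classic (xi = xi')) as [|H]; [assumption|]; exfalso; apply (proj1 HM H E).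
      * reflexivity.
    + exists (Fin (ln (N ^ 2) - ln (M ^ 2))); split.
      * exists (Rabs M); split; [apply Rabs_pos_lt; exact E|].
        intros s s' Hs Hs'; assert (s * s' <= M ^ 2) by (rewrite <- pow2_abs; nra).
        exists (Fin (ln (N ^ 2) - ln (s * s'))), (Fin (ln (M ^ 2) - ln (s * s'))); split; [|split].
        -- right; split; [exact Hne|]; eexists; split; [reflexivity|]; apply D1; lra.
        -- right; split; [apply HM; exact E|]; eexists; split; [reflexivity|]; apply D2; lra.
        -- simpl; f_equal; ring.
      * simpl; generalize (ln_increasing (M ^ 2) (N ^ 2) (sq_pos M E) Hlt); simpl; lra.
Qed.

(** * Uniform gap *)

Definition dominated (g g' : Mat) (w w' : R * R) : Prop :=
  det2 w w' ^ 2 < det2 (mv g w) (mv g' w') ^ 2.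

Definition all_dominated (g g' : Mat) (p q p' q' : option R) : Prop :=
  forall xi xi', xi = p \/ xi = q -> xi' = p' \/ xi' = q' -> dominated g g' (vec xi) (vec xi').

Definition uniform_gap (g g' : Mat) (p q p' q' : option R) : Prop :=
  exists K, K > 0 /\ forall z z', onGeod p q z -> onGeod p' q' z' ->
    dH (actH g z) (actH g' z') - dH z z' >= K.

(** Stated for every factor in [[1, l]], so that several such bounds can share the minimum of their
    [l]. For [a = 0] the value 2 is arbitrary. *)
Lemma ratio_gt1 (a b : R) : 0 <= a -> a < b -> exists l, 1 < l /\ forall l', 1 <= l' <= l -> l' * a <= b.
Proof.
  intros Ha Hab; destruct (Req_dec_T a 0) as [E|E].
  - exists 2; split; [lra|]; intros; rewrite E; lra.
  - exists (b / a); assert (H : 0 < a) by lra; split.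
    + apply (Rmult_lt_reg_r a); [exact H|]; field_simplify; lra.
    + intros l' [_ Hl]; apply (Rmult_le_compat_r a) in Hl; [|exact Ha].
      replace (b / a * a) with b in Hl by (field; exact E); exact Hl.
Qed.

Lemma all_dominated_gap (g g' : Mat) (p q p' q' : option R) :
  inSL g -> inSL g' -> p <> q -> p' <> q' ->
  all_dominated g g' p q p' q' -> uniform_gap g g' p q p' q'.
Proof.
  intros Hg Hg' Hpq Hpq' HD.
  destruct (ratio_gt1 _ _ (pow2_ge_0 _) (HD p p' (or_introl eq_refl) (or_introl eq_refl))) as [l1 [L1 R1]].
  destruct (ratio_gt1 _ _ (pow2_ge_0 _) (HD p q' (or_introl eq_refl) (or_intror eq_refl))) as [l2 [L2 R2]].
  destruct (ratio_gt1 _ _ (pow2_ge_0 _) (HD q p' (or_intror eq_refl) (or_introl eq_refl))) as [l3 [L3 R3]].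
  destruct (ratio_gt1 _ _ (pow2_ge_0 _) (HD q q' (or_intror eq_refl) (or_intror eq_refl))) as [l4 [L4 R4]].
  set (l := Rmin (Rmin l1 l2) (Rmin l3 l4)).
  assert (Hl : 1 < l) by (unfold l; repeat apply Rmin_glb_lt; assumption).
  assert (Hl1 : l <= l1) by (eapply Rle_trans; [apply Rmin_l | apply Rmin_l]).
  assert (Hl2 : l <= l2) by (eapply Rle_trans; [apply Rmin_l | apply Rmin_r]).
  assert (Hl3 : l <= l3) by (eapply Rle_trans; [apply Rmin_r | apply Rmin_l]).
  assert (Hl4 : l <= l4) by (eapply Rle_trans; [apply Rmin_r | apply Rmin_r]).
  specialize (R1 l ltac:(lra)); specialize (R2 l ltac:(lra)).
  specialize (R3 l ltac:(lra)); specialize (R4 l ltac:(lra)).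
  exists (ln l); split; [rewrite <- ln_1; apply ln_increasing; lra|].
  intros z z' Hz Hz'; assert (Hy := proj1 Hz); assert (Hy' := proj1 Hz').
  destruct (inClosure_comb p q (Int z) Hpq Hz) as [a [c [E [Ha [Hc _]]]]].
  destruct (inClosure_comb p' q' (Int z') Hpq' Hz') as [a' [c' [E' [Ha' [Hc' _]]]]].
  destruct (dH_chd z z' Hy Hy') as [-> H1].
  destruct (dH_chd _ _ (valid_actH g z Hg Hy) (valid_actH g' z' Hg' Hy')) as [-> _].
  apply arcosh_gap; [exact H1 | lra|].
  rewrite chd_act by assumption; unfold chd.
  unfold Rdiv; rewrite <- Rmult_assoc; apply Rmult_le_compat_r;
    [left; apply Rinv_0_lt_compat; nra|].
  (* On the lines the middle coefficients vanish, so only squared determinants with nonnegative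
     weights remain. *)
  rewrite E, E', !sact_comb, !pairing_comb.
  apply (Rmult_le_compat_l (a * a')) in R1; [|nra].
  apply (Rmult_le_compat_l (a * c')) in R2; [|nra].
  apply (Rmult_le_compat_l (c * a')) in R3; [|nra].
  apply (Rmult_le_compat_l (c * c')) in R4; [|nra].
  lra.
Qed.

(** The determinant is 1, [ln t] is an arc length parameter, and [t -> +oo] leads to [p]. *)
Lemma geod_point (p q : option R) (t : R) : p <> q -> 0 < t ->
  exists z, onGeod p q z /\ toSym (Int z) =
    sscale (snd z) (comb (vec p) (vec q) (t / Rabs (det2 (vec p) (vec q))) 0
                         (/ (t * Rabs (det2 (vec p) (vec q))))).
Proof.
  intros Hpq Ht; assert (Hd := proj1 (det2_vec_neq0 p q) Hpq).
  assert (Hda := Rabs_pos_lt _ Hd); assert (Hdd := pow2_abs (det2 (vec p) (vec q))).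
  set (d := Rabs (det2 (vec p) (vec q))) in *.
  destruct (point_of_sym (comb (vec p) (vec q) (t / d) 0 (/ (t * d)))) as [z [Hz E]].
  - rewrite sdet_comb, <- Hdd; field; lra.
  - apply sC_comb_pos; [apply Rdiv_lt_0_compat; lra | apply Rinv_0_lt_compat; nra | exact Hd].
  - exists z; split; [|exact E].
    apply (inClosure_iff p q (Int z) Hpq); split; [exact Hz|].
    rewrite Sfun_sform, E.
    unfold sform, sscale, comb; simpl; ring.
Qed.

Lemma limit_le (a b c : R) : 0 <= b -> (forall y, 0 < y <= 1 -> c <= a + b * y) -> c <= a.
Proof.
  intros Hb H; destruct (Rle_lt_dec c a) as [|Hlt]; [assumption | exfalso].
  set (y := Rmin 1 ((c - a) / (2 * (b + 1)))).
  assert (Hp : 0 < (c - a) / (2 * (b + 1))) by (apply Rdiv_lt_0_compat; lra).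
  assert (Hy : 0 < y <= 1) by (split; [apply Rmin_glb_lt; lra | apply Rmin_l]).
  assert (Hy' : y <= (c - a) / (2 * (b + 1))) by apply Rmin_r.
  apply (Rmult_le_compat_l (b + 1)) in Hy'; [|lra].
  replace ((b + 1) * ((c - a) / (2 * (b + 1)))) with ((c - a) / 2) in Hy' by (field; lra).
  specialize (H y Hy); lra.
Qed.

(** Let both points run to the ends [p] and [p']. The leading terms give [exp K * M11^2 <= N11^2],
    which is strict domination unless [M11 = 0]; in that case [N11 = 0] has to be excluded
    separately. *)
Lemma uniform_gap_dominated (g g' : Mat) (p q p' q' : option R) :
  inSL g -> inSL g' -> p <> q -> p' <> q' ->
  uniform_gap g g' p q p' q' -> dominated g g' (vec p) (vec p').
Proof.
  intros Hg Hg' Hpq Hpq' [K [HK HC]]; unfold dominated.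
  assert (Hd := Rabs_pos_lt _ (proj1 (det2_vec_neq0 p q) Hpq)).
  assert (Hd' := Rabs_pos_lt _ (proj1 (det2_vec_neq0 p' q') Hpq')).
  set (u := vec p) in *; set (v := vec q) in *; set (u' := vec p') in *; set (v' := vec q') in *.
  set (d := Rabs (det2 u v)) in *; set (d' := Rabs (det2 u' v')) in *.
  assert (HP := pluecker (mv g u) (mv g v) (mv g' u') (mv g' v')).
  rewrite (det2_mv g), (det2_mv g') in HP by assumption.
  assert (key : forall t s, 0 < t -> 0 < s -> exists c c',
     2 * (d * d') * c = t * s * det2 u u' ^ 2 + t / s * det2 u v' ^ 2 + s / t * det2 v u' ^ 2 + / (t * s) * det2 v v' ^ 2 /\
     2 * (d * d') * c' = t * s * det2 (mv g u) (mv g' u') ^ 2 + t / s * det2 (mv g u) (mv g' v') ^ 2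
                  + s / t * det2 (mv g v) (mv g' u') ^ 2 + / (t * s) * det2 (mv g v) (mv g' v') ^ 2 /\
     exp K * (2 * c - 1) <= 2 * c' /\ exp K + exp (- K) <= 2 * c').
  { intros t s Ht Hs.
    destruct (geod_point p q t Hpq Ht) as [z [Hz E]].
    destruct (geod_point p' q' s Hpq' Hs) as [z' [Hz' E']].
    fold u v d in E; fold u' v' d' in E'.
    specialize (HC z z' Hz Hz').
    assert (Hy := proj1 Hz); assert (Hy' := proj1 Hz').
    destruct (dH_chd z z' Hy Hy') as [E1 H1].
    destruct (dH_chd _ _ (valid_actH g z Hg Hy) (valid_actH g' z' Hg' Hy')) as [E2 H2].
    rewrite E1, E2 in HC.
    exists (chd z z'), (chd (actH g z) (actH g' z')); split; [|split; [|apply arcosh_gap_inv; assumption]].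
    - unfold chd; rewrite E, E', pairing_sscale, pairing_comb; field; lra.
    - rewrite chd_act by assumption.
      rewrite E, E', !sact_sscale, !sact_comb, pairing_sscale, pairing_comb; field; lra. }
  set (M11 := det2 u u') in *; set (M12 := det2 u v') in *;
  set (M21 := det2 v u') in *; set (M22 := det2 v v') in *.
  set (N11 := det2 (mv g u) (mv g' u')) in *; set (N12 := det2 (mv g u) (mv g' v')) in *;
  set (N21 := det2 (mv g v) (mv g' u')) in *; set (N22 := det2 (mv g v) (mv g' v')) in *.
  set (D := d * d') in *; assert (HDp : 0 < D) by (unfold D; nra).
  assert (Hk : 1 < exp K) by (rewrite <- exp_0; apply exp_increasing; lra).
  assert (HKi : exp K * exp (- K) = 1) by (rewrite <- exp_plus, Rplus_opp_r; apply exp_0).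
  set (k := exp K) in *; set (k' := exp (- K)) in *; clearbody k k'.
  assert (Hle : k * M11 ^ 2 <= N11 ^ 2).
  { apply (limit_le _ (N12 ^ 2 + N21 ^ 2 + N22 ^ 2 + k * D)).
    - generalize (pow2_ge_0 N12) (pow2_ge_0 N21) (pow2_ge_0 N22); nra.
    (* With both parameters equal to [1 / sqrt y], multiplication by [y] turns the expansions into
       polynomials in [y], and [y] tends to 0. *)
    - intros y Hy; set (T := / sqrt y).
      assert (Hsy : 0 < sqrt y) by (apply sqrt_lt_R0; lra).
      assert (HT : 0 < T) by (apply Rinv_0_lt_compat; exact Hsy).
      assert (HTT : T * T = / y) by (unfold T; rewrite <- Rinv_mult, sqrt_sqrt; lra).
      destruct (key T T HT HT) as [c [c' [E [E' [F _]]]]].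
      replace (T / T) with 1 in * by (field; lra); rewrite HTT, Rinv_inv in *.
      assert (F' : k * (2 * D * c - D) <= 2 * D * c') by nra.
      rewrite E, E' in F'.
      apply (Rmult_le_compat_l y) in F'; [|lra].
      replace (y * (/ y * N11 ^ 2 + 1 * N12 ^ 2 + 1 * N21 ^ 2 + y * N22 ^ 2))
        with (N11 ^ 2 + N12 ^ 2 * y + N21 ^ 2 * y + N22 ^ 2 * (y * y)) in F' by (field; lra).
      replace (y * (k * (/ y * M11 ^ 2 + 1 * M12 ^ 2 + 1 * M21 ^ 2 + y * M22 ^ 2 - D)))
        with (k * M11 ^ 2 + k * y * (M12 ^ 2 + M21 ^ 2 + y * M22 ^ 2) - k * D * y) in F' by (field; lra).
      assert (0 <= k * y * (M12 ^ 2 + M21 ^ 2 + y * M22 ^ 2)).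
      { apply Rmult_le_pos; [nra|].
        generalize (pow2_ge_0 M12) (pow2_ge_0 M21) (pow2_ge_0 M22); nra. }
      assert (N22 ^ 2 * (y * y) <= N22 ^ 2 * y)
        by (apply Rmult_le_compat_l; [apply pow2_ge_0 | nra]).
      lra. }
  destruct (Req_dec_T M11 0) as [HM|HM]; [|generalize (sq_pos _ HM); nra].
  rewrite HM; replace (0 ^ 2) with 0 by ring; apply sq_pos; intros HN.
  (* Otherwise the images of [l] and [l'] are asymptotic, and distances between them
     come arbitrarily close to 0. *)
  exfalso.
  assert (HD : Rabs N12 * Rabs N21 = D).
  { unfold D, d, d'; rewrite <- !Rabs_mult; rewrite <- HP, HN, <- (Rabs_Ropp (0 * N22 - _)).
    f_equal; ring. }
  assert (HN1 := Rabs_pos N12); assert (HN2 := Rabs_pos N21).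
  assert (HN1' : 0 < Rabs N12) by nra; assert (HN2' : 0 < Rabs N21) by nra.
  rewrite <- (pow2_abs N12), <- (pow2_abs N21) in key.
  set (A12 := Rabs N12) in *; set (A21 := Rabs N21) in *.
  assert (Hle2 : k + k' <= 2).
  { apply (limit_le _ (N22 ^ 2 / D ^ 2)).
    - apply Rmult_le_pos; [apply pow2_ge_0|]; left; apply Rinv_0_lt_compat, sq_pos; lra.
    - intros y Hy; set (T := / sqrt y).
      assert (Hsy : 0 < sqrt y) by (apply sqrt_lt_R0; lra).
      assert (HT : 0 < T) by (apply Rinv_0_lt_compat; exact Hsy).
      assert (HTT : T * T = / y) by (unfold T; rewrite <- Rinv_mult, sqrt_sqrt; lra).
      (* The ratio of the parameters makes both middle terms equal to [D], so that [2 * c'] tends to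
         2, against [k + k' > 2]. *)
      destruct (key (T * A21) (T * A12)) as [c [c' [_ [E' [_ F]]]]]; [nra | nra|].
      apply Rle_trans with (1 := F); right.
      apply (Rmult_eq_reg_l D); [|lra].
      transitivity (2 * D * c'); [ring|]; rewrite E', HN.
      replace (T * A21 / (T * A12) * A12 ^ 2) with D by (rewrite <- HD; field; lra).
      replace (T * A12 / (T * A21) * A21 ^ 2) with D by (rewrite <- HD; field; lra).
      replace (T * A21 * (T * A12)) with (D / y).
      + field; lra.
      + transitivity (T * T * (A12 * A21)); [rewrite HTT, HD; field; lra | ring]. }
  nra.
Qed.

Lemma onGeod_sym (p q : option R) (z : R * R) : onGeod p q z -> onGeod q p z.
Proof.
  unfold onGeod; destruct p, q; intros [H1 H2]; split; try assumption.
  replace (r0 + r) with (r + r0) by ring; rewrite H2; field.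
Qed.

Lemma inClosure_sym (p q : option R) (P : pt) : inClosure p q P -> inClosure q p P.
Proof. destruct P; simpl; [apply onGeod_sym | tauto]. Qed.

Lemma uniform_gap_iff (g g' : Mat) (p q p' q' : option R) :
  inSL g -> inSL g' -> p <> q -> p' <> q' ->
  (uniform_gap g g' p q p' q' <-> all_dominated g g' p q p' q').
Proof.
  intros Hg Hg' Hpq Hpq'; split; [|apply all_dominated_gap; assumption].
  intros [K [HK H]] xi xi' [-> | ->] [-> | ->].
  - apply (uniform_gap_dominated g g' p q p' q'); try assumption; exists K; auto.
  - apply (uniform_gap_dominated g g' p q q' p'); try assumption; try congruence.
    exists K; auto using onGeod_sym.
  - apply (uniform_gap_dominated g g' q p p' q'); try assumption; try congruence.
    exists K; auto using onGeod_sym.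
  - apply (uniform_gap_dominated g g' q p q' p'); try assumption; try congruence.
    exists K; auto using onGeod_sym.
Qed.

(** A common interior point would be at distance 0 from itself, against the uniform gap; a common
    ideal point contradicts [Fpos_iff]. *)
Lemma closures_disjoint (g g' : Mat) (p q p' q' : option R) :
  inSL g -> inSL g' -> p <> q -> p' <> q' -> all_dominated g g' p q p' q' ->
  ~ exists P, imgClos g p q P /\ imgClos g' p' q' P.
Proof.
  intros Hg Hg' Hpq Hpq' HD [P [[P0 [H0 E0]] [P1 [H1 E1]]]].
  destruct P0 as [z|xi], P1 as [z'|xi']; simpl in E0, E1; try congruence.
  - destruct (all_dominated_gap g g' p q p' q') as [K [HK HC]]; try assumption.
    specialize (HC z z' H0 H1).
    assert (Ez : actH g z = actH g' z') by congruence; rewrite Ez in HC.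
    assert (Hy := proj1 H0); assert (Hy' := proj1 H1).
    destruct (dH_chd z z' Hy Hy') as [E2 H2]; apply arcosh_nonneg in H2.
    assert (Hv := valid_actH g' z' Hg' Hy').
    destruct (dH_chd _ _ Hv Hv) as [E3 _].
    rewrite (arcosh_eq_ln _ 1) in E3; [rewrite ln_1 in E3; lra | lra|].
    clear - Hv; set (w := actH g' z') in *; clearbody w.
    unfold chd, pairing; simpl; field; lra.
  - assert (HD' := HD xi xi' H0 H1); apply (Fpos_iff g g' xi xi' Hg Hg') in HD'.
    destruct HD' as [HD' _]; congruence.
Qed.

(** * Crooked planes *)

(* [k] lies in [g] times the set of isometries with nonrepelling fixed point [P]. *)
Definition carries (g k : Mat) (P : pt) : Prop :=
  valid P /\ exists l, 1 <= l /\ sact k (toSym P) = sscale l (sact g (toSym P)).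

(** Apply [g] to the eigenvector equation of [h = g^-1 k]. The set [A] of points covers both crooked
    planes and half-spaces. *)
Lemma leftTr_nonrep (g k : Mat) (A : pt -> Prop) (S : Mat -> Prop) :
  inSL g -> inSL k -> (forall h, inSL h -> (S h <-> exists P, A P /\ nonrep h P)) ->
  (leftTr g S k <-> exists P, A P /\ carries g k P).
Proof.
  intros Hg Hk HS; split.
  - intros [h [Hh [HSh E]]]; apply (HS h Hh) in HSh; destruct HSh as [P [HA HP]].
    exists P; split; [exact HA|].
    apply (nonrep_iff h P Hh) in HP; destruct HP as [HP [l [Hl El]]].
    split; [exact HP|]; exists l; split; [exact Hl|].
    rewrite (sact_peq _ _ _ E), sact_mmul, El, sact_sscale; reflexivity.
  - intros [P [HA [HP [l [Hl El]]]]].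
    assert (Hi := inSL_minv g Hg).
    assert (Hh : inSL (mmul (minv g) k)) by (apply inSL_mmul; assumption).
    exists (mmul (minv g) k); split; [exact Hh|]; split.
    + apply HS; [exact Hh|]; exists P; split; [exact HA|].
      apply nonrep_iff; [exact Hh|]; split; [exact HP|]; exists l; split; [exact Hl|].
      rewrite sact_mmul, El, sact_sscale, sact_minv by exact Hg; reflexivity.
    + left; symmetry; apply mmul_minv_r; exact Hg.
Qed.

Lemma leftTr_Cset (g k : Mat) (p q : option R) : inSL g -> inSL k ->
  (leftTr g (Cset p q) k <-> exists P, inClosure p q P /\ carries g k P).
Proof. intros Hg Hk; apply leftTr_nonrep; [assumption..|]; intros h _; reflexivity. Qed.

Lemma pairing_toSym_nonneg (P P' : pt) : 0 <= pairing (toSym P) (toSym P').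
Proof.
  destruct P as [z|xi].
  - destruct P' as [z'|xi'].
    + unfold pairing; simpl.
      generalize (pow2_ge_0 (fst z - fst z')) (pow2_ge_0 (snd z)) (pow2_ge_0 (snd z')); lra.
    + replace (pairing _ _) with (pairing (toSym (Ide xi')) (toSym (Int z)))
        by (unfold pairing; simpl; ring).
      rewrite (toSym_Ide xi' xi'), pairing_qform; apply qform_toSym_nonneg.
  - rewrite (toSym_Ide xi xi), pairing_qform; apply qform_toSym_nonneg.
Qed.

(** As [k] preserves the pairing, the right side is [l * l' >= 1] times the left side, which is
    nonnegative. *)
Lemma carries_pairing (g g' k : Mat) (P P' : pt) : inSL g -> inSL g' -> inSL k ->
  carries g k P -> carries g' k P' ->
  pairing (sact g (toSym P)) (sact g' (toSym P')) <= pairing (toSym P) (toSym P').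
Proof.
  intros Hg Hg' Hk [HP [l [Hl E]]] [HP' [l' [Hl' E']]].
  rewrite <- (pairing_sact k (toSym P)), E, E', pairing_sscale by exact Hk.
  assert (H : 0 <= pairing (sact g (toSym P)) (sact g' (toSym P'))).
  { destruct (sact_toSym g P Hg HP) as [J [HJ ->]].
    destruct (sact_toSym g' P' Hg' HP') as [J' [HJ' ->]].
    rewrite pairing_sscale; apply Rmult_le_pos; [nra | apply pairing_toSym_nonneg]. }
  assert (1 <= l * l') by nra; nra.
Qed.

Lemma quad_pos (a c a' c' x1 x2 x3 x4 : R) :
  0 <= a -> 0 <= c -> 0 < a + c -> 0 <= a' -> 0 <= c' -> 0 < a' + c' ->
  0 < x1 -> 0 < x2 -> 0 < x3 -> 0 < x4 ->
  0 < a * a' * x1 + a * c' * x2 + c * a' * x3 + c * c' * x4.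
Proof.
  intros Ha Hc Hac Ha' Hc' Hac' H1 H2 H3 H4.
  assert (P1 : 0 <= a * a' * x1) by (repeat apply Rmult_le_pos; lra).
  assert (P2 : 0 <= a * c' * x2) by (repeat apply Rmult_le_pos; lra).
  assert (P3 : 0 <= c * a' * x3) by (repeat apply Rmult_le_pos; lra).
  assert (P4 : 0 <= c * c' * x4) by (repeat apply Rmult_le_pos; lra).
  destruct (Rle_lt_or_eq_dec 0 a Ha) as [Ka|Ka];
  destruct (Rle_lt_or_eq_dec 0 a' Ha') as [Ka'|Ka'].
  - assert (0 < a * a' * x1) by (repeat apply Rmult_lt_0_compat; lra); lra.
  - assert (0 < a * c' * x2) by (repeat apply Rmult_lt_0_compat; lra); lra.
  - assert (0 < c * a' * x3) by (repeat apply Rmult_lt_0_compat; lra); lra.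
  - assert (0 < c * c' * x4) by (repeat apply Rmult_lt_0_compat; lra); lra.
Qed.

Lemma all_dominated_disjoint (g g' : Mat) (p q p' q' : option R) :
  inSL g -> inSL g' -> p <> q -> p' <> q' -> all_dominated g g' p q p' q' ->
  disjointG (leftTr g (Cset p q)) (leftTr g' (Cset p' q')).
Proof.
  intros Hg Hg' Hpq Hpq' HD [k [Hk [H H']]].
  apply (leftTr_Cset g k p q Hg Hk) in H; apply (leftTr_Cset g' k p' q' Hg' Hk) in H'.
  destruct H as [P [HP Hc]], H' as [P' [HP' Hc']].
  assert (L := carries_pairing g g' k P P' Hg Hg' Hk Hc Hc').
  destruct (inClosure_comb p q P Hpq HP) as [a [c [E [Ha [Hc0 Hac]]]]].
  destruct (inClosure_comb p' q' P' Hpq' HP') as [a' [c' [E' [Ha' [Hc0' Hac']]]]].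
  rewrite E, E', !sact_comb, !pairing_comb in L.
  assert (D1 := HD p p' (or_introl eq_refl) (or_introl eq_refl)).
  assert (D2 := HD p q' (or_introl eq_refl) (or_intror eq_refl)).
  assert (D3 := HD q p' (or_intror eq_refl) (or_introl eq_refl)).
  assert (D4 := HD q q' (or_intror eq_refl) (or_intror eq_refl)).
  unfold dominated in *.
  assert (Q := quad_pos a c a' c' _ _ _ _ Ha Hc0 Hac Ha' Hc0' Hac'
    (proj2 (Rlt_0_minus _ _) D1) (proj2 (Rlt_0_minus _ _) D2) (proj2 (Rlt_0_minus _ _) D3) (proj2 (Rlt_0_minus _ _) D4)).
  lra.
Qed.

(** * Construction of common elements *)

(** The matrix with columns [c], [d] times the inverse of the one with columns [a], [b]. *)
Lemma exists_SL_basis (a b c d : R * R) : det2 a b <> 0 -> det2 c d = det2 a b ->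
  exists k, inSL k /\ mv k a = c /\ mv k b = d.
Proof.
  intros Hab Hcd.
  exists (mkMat ((fst c * snd b - fst d * snd a) / det2 a b)
                ((fst d * fst a - fst c * fst b) / det2 a b)
                ((snd c * snd b - snd d * snd a) / det2 a b)
                ((snd d * fst a - snd c * fst b) / det2 a b)).
  split; [|split].
  - unfold inSL; simpl.
    transitivity (det2 c d / det2 a b); [unfold det2 in *; field; exact Hab|].
    rewrite Hcd; field; exact Hab.
  - apply pair_eq; unfold mv, det2 in *; simpl; field; exact Hab.
  - apply pair_eq; unfold mv, det2 in *; simpl; field; exact Hab.
Qed.

(* [rotate X] is a multiple of the rotation by a right angle about the point of the
   hyperbolic plane represented by [X]. *)
Definition rotate (X : Sym) (w : R * R) : R * R :=
  (sA X * snd w - sB X * fst w, sB X * snd w - sC X * fst w).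

Lemma det2_rotate (X : Sym) (w : R * R) : det2 w (rotate X w) = - qform X w.
Proof. unfold det2, rotate, qform; simpl; ring. Qed.

Lemma comb_rotate (X : Sym) (w : R * R) : comb w (rotate X w) (sdet X) 0 1 = sscale (qform X w) X.
Proof. apply Sym_eq; unfold comb, rotate, qform, sdet, sscale; simpl; ring. Qed.

(** By [comb_rotate], [X] is diagonal in the basis [w], [rotate X w], up to scale, and [Y] likewise;
    so [k] only has to match the bases. The factor [l] equalises their determinants. *)
Lemma exists_SL_ideal_interior (X Y : Sym) (w w2 : R * R) :
  sdet X = sdet Y -> 0 < qform Y w2 -> qform Y w2 <= qform X w ->
  exists k l, inSL k /\ 1 <= l ^ 2 /\ mv k w = vscale l w2 /\ sact k X = Y.
Proof.
  intros HXY HY Hle.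
  assert (Hr : 1 <= qform X w / qform Y w2).
  { apply (Rmult_le_reg_r (qform Y w2)); [exact HY|]; field_simplify; lra. }
  set (l := sqrt (qform X w / qform Y w2)).
  assert (Hl : l ^ 2 = qform X w / qform Y w2).
  { unfold l; rewrite <- Rsqr_pow2; apply Rsqr_sqrt; lra. }
  assert (Hq : qform Y (vscale l w2) = qform X w).
  { rewrite qform_vscale, Hl; field; lra. }
  destruct (exists_SL_basis w (rotate X w) (vscale l w2) (rotate Y (vscale l w2))) as [k [Hk [E1 E2]]].
  - rewrite det2_rotate; lra.
  - rewrite !det2_rotate, Hq; reflexivity.
  - exists k, l; split; [exact Hk|]; split; [lra|]; split; [exact E1|].
    assert (E : sscale (qform X w) (sact k X) = sscale (qform X w) Y).
    { rewrite <- sact_sscale, <- comb_rotate, sact_comb, E1, E2, HXY, comb_rotate, Hq; reflexivity. }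
    apply (f_equal (sscale (/ qform X w))) in E; rewrite !sscale_sscale in E.
    replace (/ qform X w * qform X w) with 1 in E by (field; lra).
    rewrite !sscale_1 in E; exact E.
Qed.

Lemma carries_Ide (g k : Mat) (xi : option R) (l : R) :
  1 <= l ^ 2 -> mv k (vec xi) = vscale l (mv g (vec xi)) -> carries g k (Ide xi).
Proof.
  intros Hl E; split; [exact I|]; exists (l ^ 2); split; [exact Hl|].
  rewrite (toSym_Ide xi xi), !sact_comb, E.
  apply Sym_eq; unfold comb, vscale, sscale; simpl; ring.
Qed.

(** If [N <> 0], prescribe [k] at both ideal points. If [M = N = 0], the points and their images
    coincide, and [k] expands enough there. If only [N] vanishes, an interior point of the second
    line replaces [p']. *)
Lemma not_dominated_common (g g' : Mat) (xi p' q' : option R) :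
  inSL g -> inSL g' -> p' <> q' -> ~ dominated g g' (vec xi) (vec p') ->
  exists k P', inSL k /\ carries g k (Ide xi) /\ inClosure p' q' P' /\ carries g' k P'.
Proof.
  intros Hg Hg' Hpq' HD; unfold dominated in HD; apply Rnot_lt_le in HD.
  set (w := vec xi) in *; set (u' := vec p') in *.
  set (N := det2 (mv g w) (mv g' u')) in *; set (M := det2 w u') in *.
  destruct (Req_dec_T N 0) as [HN|HN].
  - destruct (Req_dec_T M 0) as [HM|HM].
    + assert (Exi : xi = p').
      { destruct (classic (xi = p')) as [|H]; [assumption|].
        exfalso; apply (proj1 (det2_vec_neq0 xi p') H); exact HM. }
      subst xi.
      destruct (mv_vec g p' Hg) as [j [Hj Ej]]; destruct (mv_vec g' p' Hg') as [j' [Hj' Ej']].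
      assert (Eact : actB g p' = actB g' p').
      { destruct (classic (actB g p' = actB g' p')) as [|H]; [assumption|]; exfalso.
        apply det2_vec_neq0 in H.
        assert (HN' : j * j' * det2 (vec (actB g p')) (vec (actB g' p')) = 0).
        { rewrite <- det2_vscale, <- Ej, <- Ej'; exact HN. }
        apply Rmult_integral in HN'; destruct HN' as [HN'|]; [|contradiction].
        apply Rmult_integral in HN'; tauto. }
      set (r := j / j').
      assert (Er : mv g u' = vscale r (mv g' u')).
      { unfold u'; rewrite Ej, Ej', Eact; apply pair_eq; unfold vscale, r; simpl; field; exact Hj'. }
      assert (Hr : r <> 0).
      { unfold r, Rdiv; apply Rmult_integral_contrapositive; split; [exact Hj | apply Rinv_neq_0_compat; exact Hj']. }
      assert (Hr2 := sq_pos r Hr).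
      (* Chosen so that [l >= 1] and [l * |r| = |r| + 1 >= 1] hold together. *)
      set (l := 1 + / Rabs r).
      assert (Hra := Rabs_pos_lt r Hr).
      assert (Hri : 0 < / Rabs r) by (apply Rinv_0_lt_compat; exact Hra).
      assert (Hv0 := vec_neq0 p'); fold u' in Hv0.
      set (o := (- snd u', fst u')).
      assert (Hdet : det2 u' o <> 0).
      { unfold det2, o; simpl; destruct Hv0 as [H|H]; apply sq_pos in H;
          generalize (pow2_ge_0 (fst u')) (pow2_ge_0 (snd u')); lra. }
      destruct (exists_SL_basis u' o (vscale l (mv g u')) (vscale (/ l) (mv g o))) as [k [Hk [E1 _]]].
      * exact Hdet.
      * rewrite det2_vscale, det2_mv by exact Hg; unfold l; field; lra.
      * exists k, (Ide p'); split; [exact Hk|].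
        split; [apply (carries_Ide g k p' l); [unfold l; nra | exact E1]|].
        split; [left; reflexivity|].
        apply (carries_Ide g' k p' (l * r)).
        -- rewrite Rpow_mult_distr, <- (pow2_abs r), <- Rpow_mult_distr.
           replace (l * Rabs r) with (Rabs r + 1) by (unfold l; field; lra); nra.
        -- fold u'; rewrite E1, Er; apply pair_eq; unfold vscale; simpl; ring.
    + (* [g xi = g' p'] but [xi <> p']: far out towards [p'] on the geodesic, the
         Busemann function of [xi] exceeds that of its image. *)
      set (v' := vec q') in *.
      set (N2 := det2 (mv g' v') (mv g w)).
      assert (HMa := Rabs_pos_lt M HM).
      (* Then [t * |M|] exceeds [|N2|], which is what comparing [Hq1] with [Hq2] requires. *)
      set (t := (Rabs N2 + 1) / Rabs M).
      assert (HN2 := Rabs_pos N2).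
      assert (Ht : 0 < t) by (apply Rdiv_lt_0_compat; lra).
      destruct (geod_point p' q' t Hpq' Ht) as [z [Hz E]]; fold u' v' in E.
      assert (Hdet := proj1 (det2_vec_neq0 p' q') Hpq').
      assert (Hd := Rabs_pos_lt _ Hdet).
      fold u' v' in Hdet, Hd; set (d := Rabs (det2 u' v')) in *.
      assert (Hy := proj1 Hz); set (y := snd z) in *.
      (* Otherwise [g w] would be proportional to both [g' u'] and [g' v'], which are
         independent. *)
      assert (HN2' : N2 <> 0).
      { intros E0.
        assert (G : det2 (mv g' v') (mv g' u') = 0); [|rewrite det2_mv in G by exact Hg'; apply Hdet;
           unfold det2 in *; lra].
        assert (E0' : det2 (mv g w) (mv g' v') = 0) by (unfold N2, det2 in *; lra).
        assert (Hw : exists o, det2 (mv g w) o <> 0).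
        { exists (mv g (- snd w, fst w)); rewrite det2_mv by exact Hg.
          unfold det2; simpl; destruct (vec_neq0 xi) as [H|H]; fold w in H; apply sq_pos in H;
          generalize (pow2_ge_0 (fst w)) (pow2_ge_0 (snd w)); lra. }
        destruct Hw as [o Ho].
        assert (F' := pluecker (mv g w) o (mv g' v') (mv g' u')).
        fold N in F'; rewrite E0', HN in F'.
        assert (F'' : det2 (mv g w) o * det2 (mv g' v') (mv g' u') = 0) by lra.
        apply Rmult_integral in F''; tauto. }
      assert (Hq1 : qform (sact g' (toSym (Int z))) (mv g w) = y * (N2 ^ 2 / (t * d))).
      { rewrite E, sact_sscale, sact_comb, qform_sscale, qform_comb; fold N2.
        assert (Z : det2 (mv g' u') (mv g w) = 0) by (unfold N, det2 in *; lra).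
        rewrite Z; field; lra. }
      assert (Hq2 : y * (t / d * M ^ 2) <= qform (toSym (Int z)) w).
      { rewrite E, qform_sscale, qform_comb; apply Rmult_le_compat_l; [lra|].
        replace (det2 u' w ^ 2) with (M ^ 2) by (unfold M, det2; ring).
        assert (0 <= / (t * d) * det2 v' w ^ 2); [|lra].
        apply Rmult_le_pos; [left; apply Rinv_0_lt_compat; nra | apply pow2_ge_0]. }
      assert (Htd : 0 < t * d) by (apply Rmult_lt_0_compat; lra).
      destruct (exists_SL_ideal_interior (toSym (Int z)) (sact g' (toSym (Int z))) w (mv g w))
        as [k [l [Hk [Hl [E1 E2]]]]].
      * symmetry; apply sdet_sact; exact Hg'.
      * rewrite Hq1; apply Rmult_lt_0_compat; [exact Hy|].
        apply Rdiv_lt_0_compat; [apply sq_pos; exact HN2' | exact Htd].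
      * rewrite Hq1; apply Rle_trans with (2 := Hq2); apply Rmult_le_compat_l; [lra|].
        apply (Rmult_le_reg_r (t * d)); [exact Htd|].
        replace (N2 ^ 2 / (t * d) * (t * d)) with (Rabs N2 ^ 2)
          by (rewrite pow2_abs; field; lra).
        replace (t / d * M ^ 2 * (t * d)) with ((Rabs N2 + 1) ^ 2)
          by (rewrite <- (pow2_abs M); unfold t; field; lra).
        nra.
      * exists k, (Int z); split; [exact Hk|].
        split; [apply (carries_Ide g k xi l); assumption|].
        split; [exact Hz|].
        split; [exact Hy|]; exists 1; split; [lra|]; rewrite sscale_1; exact E2.
  - assert (HM : M <> 0) by (intros E; rewrite E in HD; generalize (sq_pos N HN); lra).
    (* The factor [M / N] gives the images the determinant [M] of [w], [u']; failed domination says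
       that its square is at least 1. *)
    destruct (exists_SL_basis w u' (vscale (M / N) (mv g w)) (mv g' u')) as [k [Hk [E1 E2]]].
    + exact HM.
    + transitivity (M / N * N); [unfold N, det2, vscale; simpl; ring|].
      fold M; field; exact HN.
    + exists k, (Ide p'); split; [exact Hk|].
      split; [apply (carries_Ide g k xi (M / N)); [|exact E1]|].
      * assert (HNs := sq_pos N HN); apply (Rmult_le_reg_r (N ^ 2)); [exact HNs|].
        replace ((M / N) ^ 2 * N ^ 2) with (M ^ 2) by (field; exact HN); lra.
      * split; [left; reflexivity|].
        apply (carries_Ide g' k p' 1); [lra|]; fold u'; rewrite E2.
        apply pair_eq; unfold vscale; simpl; ring.
Qed.

Lemma disjoint_dominated (g g' : Mat) (p q p' q' : option R) :
  inSL g -> inSL g' -> p' <> q' ->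
  disjointG (leftTr g (Cset p q)) (leftTr g' (Cset p' q')) -> all_dominated g g' p q p' q'.
Proof.
  intros Hg Hg' Hpq' H xi xi' Hxi Hxi'.
  destruct (classic (dominated g g' (vec xi) (vec xi'))) as [|HD]; [assumption|]; exfalso; apply H.
  assert (Hex : exists k P', inSL k /\ carries g k (Ide xi) /\ inClosure p' q' P' /\ carries g' k P').
  { destruct Hxi' as [-> | ->].
    - apply not_dominated_common; assumption.
    - destruct (not_dominated_common g g' xi q' p') as [k [P' [H1 [H2 [H3 H4]]]]];
        try assumption; try congruence.
      exists k, P'; auto using inClosure_sym. }
  destruct Hex as [k [P' [Hk [H1 [H2 H3]]]]].
  exists k; split; [exact Hk|]; split.
  - apply leftTr_Cset; [assumption..|]; exists (Ide xi); auto.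
  - apply leftTr_Cset; [assumption..|]; exists P'; auto.
Qed.

(** * Crooked half-spaces *)

(** Rescaling the endpoint coordinates changes the product of [det2] and [sform] by a square, so
    sides can be tested on the unnormalised vectors [mv g (vec p)] and [mv g (vec q)]. *)
Lemma side_act (g m : Mat) (p q : option R) (P : pt) : inSL g -> inSL m -> valid P ->
  exists r, 0 < r /\
    det2 (vec p) (vec q) * sform (mv g (vec p)) (mv g (vec q)) (sact m (toSym P)) =
    r * (det2 (vec (actB g p)) (vec (actB g q)) * Sfun (actB g p) (actB g q) (act m P)).
Proof.
  intros Hg Hm HP.
  destruct (mv_vec g p Hg) as [j [Hj E]]; destruct (mv_vec g q Hg) as [j' [Hj' E']].
  destruct (sact_toSym m P Hm HP) as [J [HJ EJ]].
  exists ((j * j') ^ 2 * J); split.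
  - apply Rmult_lt_0_compat; [|exact HJ]; apply sq_pos, Rmult_integral_contrapositive; tauto.
  - rewrite <- (det2_mv g), E, E', EJ, sform_scale, det2_vscale, Sfun_sform by exact Hg; ring.
Qed.

Lemma posSide_act (g : Mat) (p q : option R) (P : pt) : inSL g -> valid P ->
  (posSide (actB g p) (actB g q) (act g P) <-> posSide p q P).
Proof.
  intros Hg HP; destruct (side_act g g p q P Hg Hg HP) as [r [Hr E]].
  rewrite sform_sact, <- Sfun_sform in E by exact Hg.
  assert (HP' := valid_act g P Hg HP).
  unfold posSide; rewrite E.
  split; intros [_ H]; split; try assumption; [apply Rmult_lt_0_compat; assumption|].
  apply (Rmult_lt_reg_l r); [exact Hr | lra].
Qed.

Lemma Hbar_iff (g h : Mat) (p q : option R) : inSL g -> p <> q ->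
  (Hbar (fun P => posSide (actB g p) (actB g q) (act g P)) p q h <->
   exists P, det2 (vec p) (vec q) * Sfun p q P >= 0 /\ nonrep h P).
Proof.
  intros Hg Hpq; split.
  - intros [[_ [P [HP [_ [HS Hn]]]]] | [P [HP Hn]]]; exists P; (split; [|exact Hn]).
    + apply posSide_act in HS; try assumption; destruct HS as [_ HS]; lra.
    + apply (inClosure_iff p q P Hpq) in HP; destruct HP as [_ ->]; lra.
  - intros [P [HS Hn]]; assert (HP := proj1 Hn).
    destruct (Req_dec_T (Sfun p q P) 0) as [H0|H0].
    + right; exists P; split; [apply inClosure_iff; auto | exact Hn].
    + destruct (classic (isId h)) as [Hi|Hi].
      (* The identity, excluded from [Hplus], lies in the crooked plane since it fixes the endpoint
         [p]. *)
      * right; exists (Ide p); split; [left; reflexivity|]; split; [exact I | tauto].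
      * left; split; [exact Hi|]; exists P; split; [exact HP|]; split; [|split; [|exact Hn]].
        -- intros HC; apply (inClosure_iff p q P Hpq) in HC; tauto.
        -- apply posSide_act; [assumption..|]; split; [exact HP|].
           assert (det2 (vec p) (vec q) * Sfun p q P <> 0); [|lra].
           apply Rmult_integral_contrapositive; split; [apply det2_vec_neq0; exact Hpq | exact H0].
Qed.

Lemma leftTr_Hbar (g k : Mat) (p q : option R) : inSL g -> inSL k -> p <> q ->
  (leftTr g (Hbar (fun P => posSide (actB g p) (actB g q) (act g P)) p q) k <->
   exists P, det2 (vec p) (vec q) * Sfun p q P >= 0 /\ carries g k P).
Proof.
  intros Hg Hk Hpq; apply leftTr_nonrep; [assumption..|].
  intros h _; apply Hbar_iff; assumption.
Qed.

Lemma sform_vec_sact (g g' : Mat) (u v : R * R) (xi : option R) :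
  sform (mv g u) (mv g v) (sact g' (toSym (Ide xi))) =
  det2 (mv g u) (mv g' (vec xi)) * det2 (mv g v) (mv g' (vec xi)).
Proof. rewrite (toSym_Ide xi xi), sact_comb, sform_comb; ring. Qed.

(* The ideal point [xi] with [g xi = g' p'] lies in the closed positive side of [l];
   since [g xi] and [g' p'] coincide, [xi] and [p'] cannot be dominated. *)
Lemma Hbar_meet (g g' : Mat) (p q p' q' : option R) :
  inSL g -> inSL g' -> p <> q -> p' <> q' ->
  det2 (vec p) (vec q) *
    (det2 (mv g (vec p)) (mv g' (vec p')) * det2 (mv g (vec q)) (mv g' (vec p'))) >= 0 ->
  exists k P P', inSL k /\ det2 (vec p) (vec q) * Sfun p q P >= 0 /\ carries g k P /\
    inClosure p' q' P' /\ carries g' k P'.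
Proof.
  intros Hg Hg' Hpq Hpq' HS.
  set (m := mmul (minv g) g').
  assert (Hm : inSL m) by (apply inSL_mmul; [apply inSL_minv|]; assumption).
  destruct (mv_vec m p' Hm) as [j [Hj E]]; set (xi := actB m p') in *.
  assert (E' : vscale j (mv g (vec xi)) = mv g' (vec p')).
  { transitivity (mv g (vscale j (vec xi))).
    - apply pair_eq; unfold mv, vscale; simpl; ring.
    - rewrite <- E; transitivity (mv (mmul g m) (vec p')).
      + apply pair_eq; unfold mv, mmul; simpl; ring.
      + unfold m; rewrite mmul_minv_r by exact Hg; reflexivity. }
  destruct (not_dominated_common g g' xi p' q') as [k [P' [Hk [H1 [H2 H3]]]]]; try assumption.
  - unfold dominated; rewrite <- E'.
    replace (det2 (mv g (vec xi)) (vscale j (mv g (vec xi)))) with 0 by (unfold det2, vscale; simpl; ring).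
    generalize (pow2_ge_0 (det2 (vec xi) (vec p'))); lra.
  - exists k, (Ide xi), P'; split; [exact Hk|]; split; [|auto].
    rewrite Sfun_sform, <- (sform_sact g), sform_vec_sact by exact Hg.
    rewrite <- E' in HS.
    replace (det2 (mv g (vec p)) (vscale j (mv g (vec xi)))) with (j * det2 (mv g (vec p)) (mv g (vec xi))) in HS
      by (unfold det2, vscale; simpl; ring).
    replace (det2 (mv g (vec q)) (vscale j (mv g (vec xi)))) with (j * det2 (mv g (vec q)) (mv g (vec xi))) in HS
      by (unfold det2, vscale; simpl; ring).
    assert (Hj2 := sq_pos j Hj).
    apply Rle_ge, (Rmult_le_reg_l (j ^ 2)); [exact Hj2|]; lra.
Qed.

(** One half of the two lines being oriented away from each other. *)
Definition behind (g g' : Mat) (p q p' q' : option R) : Prop :=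
  forall P, imgClos g' p' q' P -> negSide (actB g p) (actB g q) P.

(** Along the second line [sform] is a nonnegative combination of its values at the two ends, so the
    signs there decide. *)
Lemma behind_iff (g g' : Mat) (p q p' q' : option R) :
  inSL g -> inSL g' -> p' <> q' ->
  (behind g g' p q p' q' <->
   det2 (vec p) (vec q) *
     (det2 (mv g (vec p)) (mv g' (vec p')) * det2 (mv g (vec q)) (mv g' (vec p'))) < 0 /\
   det2 (vec p) (vec q) *
     (det2 (mv g (vec p)) (mv g' (vec q')) * det2 (mv g (vec q)) (mv g' (vec q'))) < 0).
Proof.
  intros Hg Hg' Hpq'; split.
  - intros H.
    assert (G : forall xi, xi = p' \/ xi = q' -> det2 (vec p) (vec q) *
       (det2 (mv g (vec p)) (mv g' (vec xi)) * det2 (mv g (vec q)) (mv g' (vec xi))) < 0).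
    { intros xi Hxi.
      destruct (H (act g' (Ide xi))) as [_ Hn]; [exists (Ide xi); split; [exact Hxi | reflexivity]|].
      destruct (side_act g g' p q (Ide xi) Hg Hg' I) as [r [Hr E]].
      rewrite sform_vec_sact in E; rewrite E.
      generalize (Rmult_lt_gt_compat_neg_l _ _ _ Hn Hr); lra. }
    split; apply G; tauto.
  - intros [H1 H2] P [P0 [HP0 <-]].
    assert (HP := proj1 (proj1 (inClosure_iff p' q' P0 Hpq') HP0)).
    split; [apply valid_act; assumption|].
    destruct (side_act g g' p q P0 Hg Hg' HP) as [r [Hr E]].
    destruct (inClosure_comb p' q' P0 Hpq' HP0) as [a [c [E0 [Ha [Hc Hac]]]]].
    rewrite E0, sact_comb, sform_comb in E.
    apply (Rmult_lt_reg_l r); [exact Hr|]; rewrite <- E.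
    set (x := _ * (det2 (mv g (vec p)) (mv g' (vec p')) * _)) in H1.
    set (y := _ * (det2 (mv g (vec p)) (mv g' (vec q')) * _)) in H2.
    assert (Hxy : 0 < a * - x + c * - y).
    { destruct (Rle_lt_or_eq_dec 0 a Ha) as [Ka|Ka].
      - assert (0 < a * - x) by (apply Rmult_lt_0_compat; lra).
        assert (0 <= c * - y) by (apply Rmult_le_pos; lra); lra.
      - assert (0 < c * - y) by (apply Rmult_lt_0_compat; lra).
        rewrite <- Ka; lra. }
    unfold x, y in Hxy; lra.
Qed.

Lemma disjointG_sym (S T : Mat -> Prop) : disjointG S T -> disjointG T S.
Proof. intros H [k [H1 [H2 H3]]]; apply H; exists k; auto. Qed.

Lemma Hbar_disjoint_behind (g g' : Mat) (p q p' q' : option R) :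
  inSL g -> inSL g' -> p <> q -> p' <> q' ->
  disjointG (leftTr g (Hbar (fun P => posSide (actB g p) (actB g q) (act g P)) p q))
    (leftTr g' (Hbar (fun P => posSide (actB g' p') (actB g' q') (act g' P)) p' q')) ->
  behind g g' p q p' q'.
Proof.
  intros Hg Hg' Hpq Hpq' HD; apply behind_iff; try assumption.
  (* The pair [a], [b] is either ordering of the endpoints; the orientation of the second line stays
     that of [p'], [q']. *)
  assert (G : forall a b, a <> b -> (forall P, inClosure a b P -> inClosure p' q' P) ->
    det2 (vec p) (vec q) *
     (det2 (mv g (vec p)) (mv g' (vec a)) * det2 (mv g (vec q)) (mv g' (vec a))) < 0).
  { intros a b Hab Hin.
    match goal with |- ?x < 0 => destruct (Rlt_le_dec x 0) as [|Hx]; [assumption|] end.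
    exfalso; apply HD.
    destruct (Hbar_meet g g' p q a b) as [k [P [P' [Hk [H1 [H2 [H3 H4]]]]]]]; try assumption; [lra|].
    exists k; split; [exact Hk|]; split.
    - apply leftTr_Hbar; [assumption..|]; exists P; auto.
    - apply leftTr_Hbar; [assumption..|]; exists P'; split; [|exact H4].
      apply Hin, (inClosure_iff p' q' P' Hpq') in H3; destruct H3 as [_ ->]; lra. }
  split; [apply (G p' q') | apply (G q' p')]; auto using inClosure_sym.
Qed.

(** The signs make [x * n] nonnegative, and it dominates [x * m] in absolute value. *)
Lemma mult_le_of_sign (x s m n : R) : 0 <= x * s -> 0 < s * n -> m ^ 2 <= n ^ 2 -> x * m <= x * n.
Proof.
  intros Hx Hs Hmn.
  assert (Hxn : 0 <= x * n).
  { destruct (Rle_lt_dec 0 (x * n)) as [|Hl]; [assumption | exfalso].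
    assert (F : (x * s) * (s * n) = s ^ 2 * (x * n)) by ring.
    assert (Hs0 : s <> 0) by (intros E; rewrite E in Hs; lra).
    apply sq_pos in Hs0; nra. }
  apply Rsqr_incr_0_var; [|exact Hxn]; unfold Rsqr.
  generalize (Rmult_le_compat_l (x ^ 2) _ _ (pow2_ge_0 x) Hmn); lra.
Qed.

Lemma sq_mult_le (a b c d : R) : a ^ 2 <= c ^ 2 -> b ^ 2 <= d ^ 2 -> (a * b) ^ 2 <= (c * d) ^ 2.
Proof.
  intros H1 H2; rewrite !Rpow_mult_distr; apply Rmult_le_compat; auto using pow2_ge_0.
Qed.

(* Expand both points in the bases of endpoints: all mixed terms have a favourable sign
   after applying [g] and [g'], so domination of the endpoints makes the pairing grow. *)
Lemma behind_Hbar_disjoint (g g' : Mat) (p q p' q' : option R) :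
  inSL g -> inSL g' -> p <> q -> p' <> q' -> all_dominated g g' p q p' q' ->
  behind g g' p q p' q' -> behind g' g p' q' p q ->
  disjointG (leftTr g (Hbar (fun P => posSide (actB g p) (actB g q) (act g P)) p q))
    (leftTr g' (Hbar (fun P => posSide (actB g' p') (actB g' q') (act g' P)) p' q')).
Proof.
  intros Hg Hg' Hpq Hpq' HD HB HB' [k [Hk [H H']]].
  apply leftTr_Hbar in H; try assumption; destruct H as [P [HS Hc]].
  apply leftTr_Hbar in H'; try assumption; destruct H' as [P' [HS' Hc']].
  assert (L := carries_pairing g g' k P P' Hg Hg' Hk Hc Hc').
  apply behind_iff in HB; try assumption; apply behind_iff in HB'; try assumption.
  destruct HB as [B1 B2], HB' as [B3 B4].
  assert (D1 := HD p p' (or_introl eq_refl) (or_introl eq_refl)).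
  assert (D2 := HD p q' (or_introl eq_refl) (or_intror eq_refl)).
  assert (D3 := HD q p' (or_intror eq_refl) (or_introl eq_refl)).
  assert (D4 := HD q q' (or_intror eq_refl) (or_intror eq_refl)).
  unfold dominated in *.
  assert (Hd := sq_pos _ (proj1 (det2_vec_neq0 p q) Hpq)).
  assert (Hd' := sq_pos _ (proj1 (det2_vec_neq0 p' q') Hpq')).
  destruct (toSym_comb p q P Hpq) as [a [b [c [E [Ha [Hc0 [Hac Hb]]]]]]].
  destruct (toSym_comb p' q' P' Hpq') as [a' [b' [c' [E' [Ha' [Hc0' [Hac' Hb']]]]]]].
  rewrite E, E', !sact_comb, !pairing_comb in L.
  assert (Rev : forall x y, det2 x y = - det2 y x) by (intros; unfold det2; ring).
  rewrite (Rev (mv g' (vec p')) (mv g (vec p))), (Rev (mv g' (vec q')) (mv g (vec p))) in B3.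
  rewrite (Rev (mv g' (vec p')) (mv g (vec q))), (Rev (mv g' (vec q')) (mv g (vec q))) in B4.
  set (n1 := det2 (mv g (vec p)) (mv g' (vec p'))) in *.
  set (n2 := det2 (mv g (vec p)) (mv g' (vec q'))) in *.
  set (n3 := det2 (mv g (vec q)) (mv g' (vec p'))) in *.
  set (n4 := det2 (mv g (vec q)) (mv g' (vec q'))) in *.
  set (m1 := det2 (vec p) (vec p')) in *. set (m2 := det2 (vec p) (vec q')) in *.
  set (m3 := det2 (vec q) (vec p')) in *. set (m4 := det2 (vec q) (vec q')) in *.
  set (d := det2 (vec p) (vec q)) in *. set (d' := det2 (vec p') (vec q')) in *.
  rewrite Hb in HS; rewrite Hb' in HS'.
  (* On the closed positive side [d * Sfun >= 0], and [Sfun = - b * d^2]. *)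
  assert (Sb : 0 <= b * - d).
  { apply (Rmult_le_reg_l (d ^ 2)); [exact Hd | lra]. }
  assert (Sb' : 0 <= b' * - d').
  { apply (Rmult_le_reg_l (d' ^ 2)); [exact Hd' | lra]. }
  clear Rev HS HS' Hb Hb' E E' HD Hc Hc'.
  clearbody n1 n2 n3 n4 m1 m2 m3 m4 d d'.
  assert (T1 : 0 <= a * b' * - d') by (rewrite Rmult_assoc; apply Rmult_le_pos; assumption).
  assert (T2 : 0 <= c * b' * - d') by (rewrite Rmult_assoc; apply Rmult_le_pos; assumption).
  assert (T3 : 0 <= a' * b * - d) by (rewrite Rmult_assoc; apply Rmult_le_pos; assumption).
  assert (T4 : 0 <= c' * b * - d) by (rewrite Rmult_assoc; apply Rmult_le_pos; assumption).
  assert (T5 : 0 <= b * b' * (d * d')).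
  { replace (b * b' * (d * d')) with ((b * - d) * (b' * - d')) by ring; apply Rmult_le_pos; assumption. }
  assert (U1 : a * b' * (m1 * m2) <= a * b' * (n1 * n2)).
  { apply (mult_le_of_sign _ (- d')); [exact T1 | lra | apply sq_mult_le; lra]. }
  assert (U2 : c * b' * (m3 * m4) <= c * b' * (n3 * n4)).
  { apply (mult_le_of_sign _ (- d')); [exact T2 | lra | apply sq_mult_le; lra]. }
  assert (U3 : a' * b * (m1 * m3) <= a' * b * (n1 * n3)).
  { apply (mult_le_of_sign _ (- d)); [exact T3 | lra | apply sq_mult_le; lra]. }
  assert (U4 : c' * b * (m2 * m4) <= c' * b * (n2 * n4)).
  { apply (mult_le_of_sign _ (- d)); [exact T4 | lra | apply sq_mult_le; lra]. }
  assert (Pos : forall x y z, 0 < - x -> 0 < - y -> x * y = z -> 0 < z) by (intros; nra).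
  (* Multiplying two of the sign conditions that share [n3] leaves a square, which is divided out;
     [V2] does this with [n1]. *)
  assert (V1 : 0 < (d * d') * (n1 * n4)).
  { assert (W : 0 < n3 ^ 2 * ((d * d') * (n1 * n4))).
    { apply (Pos (d * (n1 * n3)) (d' * (n3 * n4))); [lra | lra | ring]. }
    generalize (pow2_ge_0 n3); nra. }
  assert (V2 : 0 < (d * d') * (n2 * n3)).
  { assert (W : 0 < n1 ^ 2 * ((d * d') * (n2 * n3))).
    { apply (Pos (d * (n1 * n3)) (d' * (n1 * n2))); [lra | lra | ring]. }
    generalize (pow2_ge_0 n1); nra. }
  assert (U5 : b * b' * (m1 * m4) <= b * b' * (n1 * n4)).
  { apply (mult_le_of_sign _ (d * d')); [exact T5 | lra | apply sq_mult_le; lra]. }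
  assert (U6 : b * b' * (m2 * m3) <= b * b' * (n2 * n3)).
  { apply (mult_le_of_sign _ (d * d')); [exact T5 | lra | apply sq_mult_le; lra]. }
  assert (Hlow : 0 < a * a' * (n1 ^ 2 - m1 ^ 2) + a * c' * (n2 ^ 2 - m2 ^ 2)
                 + c * a' * (n3 ^ 2 - m3 ^ 2) + c * c' * (n4 ^ 2 - m4 ^ 2)).
  { apply quad_pos; lra. }
  lra.
Qed.

(* l = geodesic with endpoints p,q ; l' = geodesic with endpoints p',q'.
   The order of (p,q) (resp. (p',q')) encodes the transverse orientation of
   g.l (resp. g'.l'): its positive side is posSide (g.p) (g.q); the orientation
   of l is the one induced via g^-1. *)
Theorem theorem3p1 (g g' : Mat) (p q p' q' : option R) :
  inSL g -> inSL g' -> p <> q -> p' <> q' ->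
  let C1 := disjointG (leftTr g (Cset p q)) (leftTr g' (Cset p' q')) in
  let C2 := exists K, K > 0 /\
      forall z z', onGeod p q z -> onGeod p' q' z' ->
        dH (actH g z) (actH g' z') - dH z z' >= K in
  let C3 := forall xi xi', (xi = p \/ xi = q) -> (xi' = p' \/ xi' = q') ->
        actB g xi <> actB g' xi' /\ Fpos g g' xi xi' in
  let Pos := fun P => posSide (actB g p) (actB g q) (act g P) in
  let Pos' := fun P => posSide (actB g' p') (actB g' q') (act g' P) in
  let away :=
      (forall P, imgClos g' p' q' P -> negSide (actB g p) (actB g q) P) /\
      (forall P, imgClos g p q P -> negSide (actB g' p') (actB g' q') P) in
  (C1 <-> C2) /\ (C2 <-> C3) /\
  (C1 -> ~ exists P, imgClos g p q P /\ imgClos g' p' q' P) /\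
  (disjointG (leftTr g (Hbar Pos p q)) (leftTr g' (Hbar Pos' p' q'))
     <-> (C1 /\ C2 /\ C3 /\ away)).
Proof.
  intros Hg Hg' Hpq Hpq' C1 C2 C3 Pos Pos' away.
  (* Each of the three conditions is equivalent to domination at all four pairs of endpoints. *)
  assert (H1 : C1 <-> all_dominated g g' p q p' q')
    by (split; [apply disjoint_dominated | apply all_dominated_disjoint]; assumption).
  assert (H2 : C2 <-> all_dominated g g' p q p' q') by (apply uniform_gap_iff; assumption).
  assert (H3 : C3 <-> all_dominated g g' p q p' q').
  { split; intros H xi xi' Hxi Hxi'; apply Fpos_iff;
      try assumption; exact (H xi xi' Hxi Hxi'). }
  split; [tauto|]; split; [tauto|]; split.
  - intros H; apply closures_disjoint; try assumption; tauto.
  - split.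
    (* The closed half-spaces contain the crooked planes. *)
    + intros H; assert (HC : C1).
      { intros [k [Hk [K1 K2]]]; apply H; exists k; split; [exact Hk|]; split.
        - destruct K1 as [h [Hh [HS E]]]; exists h; split; [exact Hh | split; [right; exact HS | exact E]].
        - destruct K2 as [h [Hh [HS E]]]; exists h; split; [exact Hh | split; [right; exact HS | exact E]]. }
      split; [exact HC|]; split; [tauto|]; split; [tauto|]; split.
      * apply Hbar_disjoint_behind; assumption.
      * apply Hbar_disjoint_behind; try assumption; apply disjointG_sym; exact H.
    + intros [HC [_ [_ [A1 A2]]]].
      apply behind_Hbar_disjoint; try assumption; tauto.
Qed.
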